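(* Let $\delta\in(0,1)$, and let $X_1,\dots,X_n$ be a stationary $\beta$-mixing sequence with marginal distribution $\mathbb{P}$. Let $k\colon\mathcal{X}\times\mathcal{X}\to\mathbb{R}$ be a reproducing kernel with $\overline{k}=\sup_{x\in\mathcal{X}}k(x,x)$. Suppose that $n$ is a multiple of $\tau^{\beta}_{n,\delta}$, where $\tau^{\beta}_{n,\delta}$ is the smallest $s\in\mathbb{N}$ such that $$s\ge t^{\beta}_{\mathsf{mix}}\left(\frac{\delta}{6(n/(2s)-1)}\right).$$ With probability at least $1-\delta$, it holds that $$\left\|\widehat{\mu}_{\mathbb{P}}(X_1,\dots,X_n)-\mu_{\mathbb{P}}\right\|_{\mathcal{H}_k}\le 2\sqrt{\left(v+\Sigma_{\tau^{\beta}_{n,\delta}}\right)\frac{\log(3/\delta)}{n}}+\frac83\,\tau^{\beta}_{n,\delta}\sqrt{\overline{k}}\,\frac{\log(3/\delta)}{n},$$ where $v=\mathbb{E}_{X\sim\mathbb{P}}\|k(X,\cdot)-\mu_{\mathbb{P}}\|_{\mathcal{H}_k}^2$ and, for $s\in\mathbb{N}$, $$\Sigma_s=\frac2s\sum_{t=2}^s(s-t+1)\rho_t,\qquad \rho_t=\mathbb{E}\left\langle k(X_t,\cdot)-\mu_{\mathbb{P}},\,k(X_1,\cdot)-\mu_{\mathbb{P}}\right\rangle_{\mathcal{H}_k}.$$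
   Context: $\mathcal{X}$ is a separable topological space; $k$ is a continuous, bounded ($\sup_xk(x,x)<\infty$) positive definite kernel with RKHS $\mathcal{H}_k$. The kernel mean embedding is the Bochner integral $\mu_{\mathbb{P}}=\mathbb{E}_{X\sim\mathbb{P}}[k(X,\cdot)]\in\mathcal{H}_k$ and $\widehat{\mu}_{\mathbb{P}}(X_1,\dots,X_n)=\frac1n\sum_{t=1}^nk(X_t,\cdot)$. For two $\sigma$-fields $\mathcal{A},\mathcal{B}$, $\beta(\mathcal{A},\mathcal{B})=\sup\frac12\sum_{i=1}^I\sum_{j=1}^J|\Pr(A_i\cap B_j)-\Pr(A_i)\Pr(B_j)|$, where the supremum is over all pairs of finite partitions $\{A_1,\dots,A_I\}$ and $\{B_1,\dots,B_J\}$ of the underlying sample space with $A_i\in\mathcal{A}$ and $B_j\in\mathcal{B}$ for all $i,j$. For $s\in\mathbb{N}$, $\beta(s)=\sup_{r\in\mathbb{N}}\beta(\sigma(\{X_t:t\le r\}),\sigma(\{X_t:t\ge r+s\}))$, where $\sigma(\{X_t\}_{t\in T})$ is the $\sigma$-field generated by the variables $X_t$, $t\in T$. The process is $\beta$-mixing when $\lim_{s\to\infty}\beta(s)=0$. For $\xi\in(0,1)$, the $\beta$-mixing time $t^{\beta}_{\mathsf{mix}}(\xi)$ is the smallest $t\in\mathbb{N}$ with $\beta(t)<\xi$. *)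

(* Defs.v *)
From HB Require Import structures.
From mathcomp Require Import all_boot all_order all_algebra.
From mathcomp Require Import all_classical all_reals all_analysis.

Set Implicit Arguments.
Unset Strict Implicit.
Unset Printing Implicit Defensive.
Import Order.TTheory GRing.Theory Num.Theory.
Import numFieldNormedType.Exports.
Local Open Scope classical_set_scope.
Local Open Scope ring_scope.

Definition separable (T : topologicalType) :=
  exists2 D : set T, countable D & dense D.

Definition borelType (T : ptopologicalType) := g_sigma_algebraType (@open T).

Section Kernels.
Context {R : realType} {S : Type}.
Implicit Types k : S -> S -> R.

Definition positive_definite_kernel k :=
  (forall x y, k x y = k y x) /\
  (forall (m : nat) (a : 'I_m -> R) (x : 'I_m -> S),
     0 <= \sum_i \sum_j a i * a j * k (x i) (x j)).

Definition bounded_kernel k := has_ubound (range (fun x => k x x)).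

(* The RKHS of k, as a Hilbert space together with an injective linear map
   [rkhs_eval] that realizes its vectors as functions S -> R;
   [rkhs_feature x] is the vector realized by the function k(x, .).  Such a
   structure is determined by k up to a unique isometry. *)
Record rkhs k := Rkhs {
  rkhs_space :> completeNormedModType R;
  rkhs_dot : {dot rkhs_space for idfun};
  rkhs_eval : rkhs_space -> S -> R;
  rkhs_feature : S -> rkhs_space;
  rkhs_normE : forall f : rkhs_space, `|f| = Num.sqrt (rkhs_dot f f);
  rkhs_eval_linear : forall (a : R) (f g : rkhs_space) (x : S),
    rkhs_eval (a *: f + g) x = a * rkhs_eval f x + rkhs_eval g x;
  rkhs_eval_inj : injective rkhs_eval;
  rkhs_featureE : forall x y : S, rkhs_eval (rkhs_feature x) y = k x y;
  rkhs_reproducing : forall (f : rkhs_space) (x : S),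
    rkhs_dot f (rkhs_feature x) = rkhs_eval f x }.

End Kernels.

Section Bochner.
Context {d} {T : measurableType d} {R : realType}.
Context {E : completeNormedModType R}.
Variable mu : probability T R.
Implicit Types (f s : T -> E).

Definition simple_vfun s :=
  finite_set (range s) /\ forall y : E, measurable (s @^-1` [set y]).

Definition simple_vintegral s : E :=
  \sum_(y \in range s) fine (mu (s @^-1` [set y])) *: y.

Definition is_bochner_integral f (I : E) :=
  exists s : nat -> T -> E,
    [/\ forall m, simple_vfun (s m),
        {ae mu, forall x, s ^~ x @ \oo --> f x},
        (\int[mu]_x `|f x - s m x|%:E)%E @[m --> \oo] --> 0%E
      & simple_vintegral (s m) @[m --> \oo] --> I].

Definition bochner_integral f : E := get (is_bochner_integral f).

End Bochner.

Section Mixing.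
Context {d d'} {Om : measurableType d} {S : measurableType d'} {R : realType}.
Variable Pr : probability Om R.

Definition beta_coef (A B : set_system Om) : \bar R :=
  ereal_sup [set x : \bar R | exists (p q : nat)
    (a : 'I_p -> set Om) (b : 'I_q -> set Om),
    [/\ partition setT a setT, partition setT b setT,
        forall i, A (a i), forall j, B (b j)
      & x = (2^-1 * \sum_i \sum_j
              `|fine (Pr (a i `&` b j)) - fine (Pr (a i)) * fine (Pr (b j))|)%:E]].

(* Processes are indexed from 0: X i is the observation usually written
   X_{i+1}. *)
Variable X : nat -> {RV Pr >-> S}.

Definition sigma_process (I : set nat) : set_system Om :=
  <<s \bigcup_(t in I) preimage_set_system setT (X t) measurable >>.

Definition beta_mix (s : nat) : \bar R :=
  ereal_sup (range (fun r : nat =>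
    beta_coef (sigma_process [set t | (t <= r)%N])
              (sigma_process [set t | (r + s <= t)%N]))).

Definition beta_mixing := beta_mix s @[s --> \oo] --> 0%E.

Definition stationary := forall (m h : nat) (A : set (m.-tuple S)),
  measurable A ->
  Pr [set w | A [tuple X (h + i)%N w | i < m]] =
  Pr [set w | A [tuple X i w | i < m]].

Definition is_least (A : set nat) (m : nat) :=
  A m /\ forall j, A j -> (m <= j)%N.

Definition is_beta_mixing_time (xi : R) (t : nat) :=
  is_least [set u | (1 <= u)%N /\ (beta_mix u < xi%:E)%E] t.

(* [xi s] is a legitimate argument of the mixing time only when it lies in
   (0,1); in particular 2 s < n, which excludes the division by zero. *)
Definition is_block_length (n : nat) (delta : R) (tau : nat) :=
  let xi (s : nat) : R := delta / (6 * (n%:R / (2 * s%:R) - 1)) in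
  is_least [set s | [/\ (1 <= s)%N, 0 < xi s < 1
    & exists2 t, is_beta_mixing_time (xi s) t & (t <= s)%N]] tau.

End Mixing.

Section Embedding.
Context {d} {Om : measurableType d} {S : ptopologicalType} {R : realType}.
Context {k : S -> S -> R} (H : rkhs k).
Variable Pr : probability Om R.

Definition mean_embedding (Q : probability (borelType S) R) : H :=
  bochner_integral Q (@rkhs_feature _ _ k H).

Definition embedding_variance (Q : probability (borelType S) R) : R :=
  \int[Q]_x (`|rkhs_feature H x - mean_embedding Q| ^+ 2).

Variable X : nat -> {RV Pr >-> borelType S}.

Definition marginal : probability (borelType S) R := distribution Pr (X 0%N).

Definition empirical_embedding (n : nat) (w : Om) : H :=
  n%:R^-1 *: \sum_(t < n) rkhs_feature H (X t w).

(* 1-based in t, hence the predecessor *)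
Definition rho (t : nat) : R :=
  \int[Pr]_w (rkhs_dot H (rkhs_feature H (X t.-1 w) - mean_embedding marginal)
                         (rkhs_feature H (X 0%N w) - mean_embedding marginal)).

Definition Sigma (s : nat) : R :=
  2 / s%:R * \sum_(2 <= t < s.+1) (s - t + 1)%:R * rho t.

End Embedding.

(* Main.v *)
(** The features are first quantized: each point is replaced by the one, among
    the first points of a dense sequence, whose feature is nearest, so that
    everything reduces to finite sums.  The n = m tau observations are cut into
    m blocks of length tau, and the blocks are split by parity.  Within a parity
    class, replacing the joint law of the K blocks by the product law costs at
    most 2 (K - 1) beta(tau) in total variation norm.  Under the product law,
    Pinelis' inequality
      cosh |x + y| <= cosh |x| + (sinh |x| / |x|) <x, y> + cosh |x| (e^|y| - 1 - |y|)
    and a Bernstein estimate bound the exponential moments of the block sum.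

    A union bound over the two classes would cost a factor 2.  Instead, with A
    and B the two class sums, Young's inequality gives, for suitable a and b
    proportional to exp (theta |A|) and exp (theta |B|),
      1_{|A + B| > r} <= (min (2, a) + min (2, b)) / 2,
    and since both terms are bounded by 2, passing to the product laws costs
    only (m - 2) beta(tau) <= delta / 3, while the product laws contribute
    2 exp (- ln (3 / delta)) = 2 delta / 3.  The bound passes to the limit of
    ever finer quantizations. *)
Require Import Defs.
From HB Require Import structures.
From mathcomp Require Import all_boot all_order all_algebra.
From mathcomp Require Import finmap.
From mathcomp Require Import all_classical all_reals all_analysis.
From mathcomp Require Import measurable_realfun.
From mathcomp Require Import ring lra.

Set Implicit Arguments.
Unset Strict Implicit.
Unset Printing Implicit Defensive.
Import Order.TTheory GRing.Theory Num.Theory.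
Import numFieldNormedType.Exports.
Local Open Scope classical_set_scope.
Local Open Scope ring_scope.

(** * Exponential inequalities *)

Section ExponentialInequalities.
Context {R : realType}.
Implicit Types x y z r a b s t : R.

Lemma cvg_series_expR x : series (exp_coeff x) n @[n --> \oo] --> expR x.
Proof. exact: is_cvg_series_exp_coeff. Qed.

(** Dominates the terms x^(n+2) / (n+2)! of the exponential series by (x^2 / 2) (x / 3)^n, the
    geometric series of [expR_bernstein]. *)
Lemma two_expn3_le_fact n : (2 * 3 ^ n <= n.+2`!)%N.
Proof.
elim: n => // n IH.
by rewrite factS expnS mulnCA; apply: leq_mul.
Qed.

Lemma expR_bernstein x : 0 <= x < 3 ->
  expR x - 1 - x <= x ^+ 2 / (2 * (1 - x / 3)).
Proof.
move=> /andP[x0 x3].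
have q1 : 0 < 1 - x / 3 by lra.
suff H n : series (exp_coeff x) n.+2 <=
    1 + x + x ^+ 2 / 2 * ((1 - (x / 3) ^+ n) / (1 - x / 3)).
  have : expR x <= 1 + x + x ^+ 2 / (2 * (1 - x / 3)).
    have := @cvg_series_expR x; rewrite -(cvg_shiftn 2) => h.
    apply: (ler_cvg_to h (cvg_cst _)); apply: nearW => n.
    rewrite /= addn2 (le_trans (H n))// lerD2l invfM [leRHS]mulrA.
    rewrite ler_wpM2l ?divr_ge0 ?sqr_ge0//.
    rewrite ler_piMl ?invr_ge0 ?(ltW q1)//.
    by rewrite gerBl exprn_ge0 ?divr_ge0.
  by lra.
elim: n => [|n IH].
  rewrite /series/= !big_nat_recr//= big_geq// /exp_coeff/=.
  by rewrite expr0 !fact0 factS fact0 expr1 subrr mul0r mulr0; lra.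
rewrite /series/= big_nat_recr//= -/(series _ _).
apply: le_trans (lerD IH (lexx _)) _.
suff : exp_coeff x n.+2 <= x ^+ 2 / 2 * (x / 3) ^+ n.
  have -> : (1 - (x / 3) ^+ n.+1) / (1 - x / 3) =
    (1 - (x / 3) ^+ n) / (1 - x / 3) + (x / 3) ^+ n.
    by rewrite exprS; field; rewrite ?lt0r_neq0//; lra.
  by rewrite mulrDr => h; lra.
rewrite /exp_coeff/= expr_div_n mulf_div -exprD add2n.
rewrite ler_wpM2l ?exprn_ge0//.
rewrite lef_pV2 ?posrE ?ltr0n ?fact_gt0 ?mulr_gt0 ?exprn_gt0//.
by rewrite -natrX -natrM ler_nat two_expn3_le_fact.
Qed.

(** This is x <= sinh x. In the difference of the two series the even terms cancel and the odd ones
    are nonnegative; 2 x is the partial sum through degree 1. *)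
Lemma expR_sub_ge x : 0 <= x -> 2 * x <= expR x - expR (- x).
Proof.
move=> x0.
have h : series (exp_coeff x) n - series (exp_coeff (- x)) n @[n --> \oo]
    --> expR x - expR (- x) by apply: cvgB; exact: cvg_series_expR.
move: h; rewrite -(cvg_shiftn 2) => h.
apply: (ler_cvg_to (cvg_cst _) h); apply: nearW => n /=.
rewrite addn2.
elim: n => [|n IH].
  rewrite /series/= !big_nat_recr//= !big_geq// /exp_coeff/=.
  by rewrite !expr0 !fact0 factS fact0 !expr1; lra.
rewrite /series/= !(big_nat_recr n.+2)//= -/(series _ _).
suff : 0 <= exp_coeff x n.+2 - exp_coeff (- x) n.+2.
  by move: IH; rewrite /series/=; lra.
rewrite /exp_coeff/= -mulrBl divr_ge0// subr_ge0 exprNn.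
case: (boolP (odd n.+2)) => h'; rewrite -signr_odd ?h' ?(negbTE h').
  by rewrite expr1 mulN1r (le_trans _ (exprn_ge0 _ x0))// oppr_le0 exprn_ge0.
by rewrite expr0 mul1r.
Qed.

Lemma convex_exprn s x y n : 0 <= s <= 1 -> 0 <= x -> 0 <= y ->
  ((1 - s) * x + s * y) ^+ n <= (1 - s) * x ^+ n + s * y ^+ n.
Proof.
move=> /andP[s0 s1] x0 y0; elim: n => [|n IH]; first by rewrite !expr0; lra.
rewrite exprS.
apply: (le_trans (ler_wpM2l _ IH)).
  by rewrite addr_ge0// mulr_ge0// subr_ge0.
rewrite -subr_ge0 !exprS.
have -> : (1 - s) * (x * x ^+ n) + s * (y * y ^+ n) -
    ((1 - s) * x + s * y) * ((1 - s) * x ^+ n + s * y ^+ n) =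
    s * (1 - s) * ((x - y) * (x ^+ n - y ^+ n)) by ring.
apply: mulr_ge0; first by rewrite mulr_ge0// subr_ge0.
have [xy|/ltW xy] := leP x y.
  by apply: mulr_le0; rewrite subr_le0// lerXn2r.
by apply: mulr_ge0; rewrite subr_ge0// lerXn2r.
Qed.

Definition cosh x := (expR x + expR (- x)) / 2.
Definition sinh x := (expR x - expR (- x)) / 2.

Lemma coshN x : cosh (- x) = cosh x.
Proof. by rewrite /cosh opprK addrC. Qed.

Lemma cosh_ge1 x : 1 <= cosh x.
Proof.
by rewrite /cosh; have := expR_ge1Dx x; have := expR_ge1Dx (- x); lra.
Qed.

Lemma expR_le_cosh x : expR x <= 2 * cosh x.
Proof. by rewrite /cosh; have := expR_ge0 (- x); lra. Qed.

(* The function [u |-> cosh (sqrt u)] is convex: its power series has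
   nonnegative coefficients. *)
Lemma cosh_sqrt_convex s r x y : 0 <= s <= 1 ->
  r ^+ 2 = (1 - s) * x ^+ 2 + s * y ^+ 2 ->
  cosh r <= (1 - s) * cosh x + s * cosh y.
Proof.
move=> s01 rE.
have C z : (series (exp_coeff z) n + series (exp_coeff (- z)) n) / 2
    @[n --> \oo] --> cosh z.
  by apply: cvgMl; apply: cvgD; exact: cvg_series_expR.
apply: (ler_cvg_to (C r)).
  by apply: cvgD; (apply: cvgM; first exact: cvg_cst); [exact: C x|exact: C y].
apply: nearW => n /=; rewrite !fctE /series/= -!big_split/= !mulr_suml !mulr_sumr.
rewrite -big_split/= ler_sum// => k _.
have E z : (exp_coeff z k + exp_coeff (- z) k) / 2 =
    (~~ odd k)%:R * ((z ^+ 2) ^+ k./2 / k`!%:R).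
  rewrite /exp_coeff/= exprNn -signr_odd -exprM mul2n.
  case: (boolP (odd k)) => /= h.
    by rewrite expr1 mul0r mulN1r mulNr subrr mul0r.
  have -> : (k./2.*2 = k)%N by rewrite -[RHS]odd_double_half (negbTE h).
  by rewrite expr0; field; rewrite pnatr_eq0 -lt0n fact_gt0.
rewrite !E rE !(mulrCA _ (_%:R)) -mulrDr ler_wpM2l//.
rewrite [X in _ <= X + _]mulrA [X in _ <= _ + X]mulrA -mulrDl.
by rewrite ler_wpM2r ?invr_ge0// convex_exprn ?sqr_ge0.
Qed.

(** The scalar form of Pinelis' inequality, with a, b, r the norms of x, y, x + y and t = <x, y>.
    With the weight s below, r^2 = (1 - s) (a - b)^2 + s (a + b)^2, so [cosh_sqrt_convex] bounds
    cosh r by cosh a cosh b + (2 s - 1) sinh a sinh b. Replacing the last sinh b by b costs at most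
    cosh a (sinh b - b), since |(2 s - 1) sinh a| <= cosh a, and cosh b + sinh b = e^b. *)
Lemma cosh_le_tangent a b t r : 0 <= a -> 0 <= b -> `|t| <= a * b ->
  r ^+ 2 = a ^+ 2 + 2 * t + b ^+ 2 ->
  cosh r <= cosh a + sinh a / a * t + cosh a * (expR b - 1 - b).
Proof.
move=> a0 b0 tab rE.
pose s := (1 + t / (a * b)) / 2.
have coshD x y : cosh (x + y) = cosh x * cosh y + sinh x * sinh y.
  by rewrite /cosh /sinh opprD !expRD; field.
have sinhN x : sinh (- x) = - sinh x by rewrite /sinh opprK; field.
have sb : b <= sinh b by rewrite /sinh; have := expR_sub_ge b0; lra.
have sa : `|sinh a| <= cosh a.
  rewrite /sinh /cosh ler_norml; have := expR_ge0 a; have := expR_ge0 (- a).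
  by move=> *; apply/andP; split; lra.
have eb : expR b = cosh b + sinh b by rewrite /cosh /sinh; field.
(* If a b = 0 then t = 0, so the default value 0 of [sinh a / a] at a = 0 does no harm. *)
have [ab0|abN0] := eqVneq (a * b) 0.
  have t0 : t = 0 by apply/eqP; rewrite -normr_le0 -ab0.
  move: rE; rewrite t0 !mulr0 !addr0 => rE.
  move/eqP: ab0; rewrite mulf_eq0 => /orP[] /eqP ab0.
    have -> : cosh r = cosh b.
      move/eqP: rE; rewrite ab0 expr0n add0r eqf_sqr => /orP[] /eqP -> //.
      exact: coshN.
    have -> : cosh a = 1 by rewrite ab0 /cosh oppr0 expR0; field.
    by rewrite eb; lra.
  have -> : cosh r = cosh a.
    move/eqP: rE; rewrite ab0 expr0n addr0 eqf_sqr => /orP[] /eqP -> //.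
    exact: coshN.
  by rewrite ab0 expR0; lra.
have abp : 0 < a * b by rewrite lt0r abN0 mulr_ge0.
have s01 : 0 <= s <= 1.
  have : `|t / (a * b)| <= 1.
    by rewrite normrM normfV (gtr0_norm abp) ler_pdivrMr// mul1r.
  by rewrite ler_norml /s => /andP[? ?]; apply/andP; split; lra.
apply: le_trans (cosh_sqrt_convex (x := a - b) (y := a + b) s01 _) _.
  by rewrite rE /s; field; rewrite -negb_or -mulf_eq0 // mulrC.
have aN0 : a != 0 by move: abN0; rewrite mulf_eq0 negb_or => /andP[].
have bN0 : b != 0 by move: abN0; rewrite mulf_eq0 negb_or => /andP[].
have -> : sinh a / a * t = (2 * s - 1) * (b * sinh a).
  by rewrite /s; field; rewrite aN0 bN0.
rewrite !coshD sinhN coshN eb.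
have H : `|(2 * s - 1) * sinh a| <= cosh a.
  rewrite normrM (le_trans _ sa)// ler_piMl//.
  by rewrite ler_norml; move/andP: s01 => [? ?]; apply/andP; split; lra.
have : (2 * s - 1) * sinh a * (sinh b - b) <= cosh a * (sinh b - b).
  by rewrite ler_wpM2r ?subr_ge0//; case/ler_normlP: H.
by nra.
Qed.

End ExponentialInequalities.

(** Inverts the Bernstein exponent. For v > 0 put s = sqrt (2 L / v), so that L = v s^2 / 2; then
    theta = s / (1 + c s / 3) gives 1 - theta c / 3 = 1 / (1 + c s / 3), and the exponent is exactly
    - L at r = v s + c L / 3. *)
Lemma bernstein_parameter {R : realType} (v c L r : R) :
  0 <= v -> 0 < c -> 0 < L -> Num.sqrt (2 * v * L) + 2 / 3 * c * L <= r ->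
  exists theta : R, [/\ 0 <= theta, theta * c < 3 &
    v * (theta ^+ 2 / (2 * (1 - theta * c / 3))) - theta * r <= - L].
Proof.
move=> v0 c0 L0 rL; have [v00|vN0] := eqVneq v 0.
  move: rL; rewrite v00 mulr0 mul0r sqrtr0 add0r => rL.
  (* As v tends to 0 the parameter above tends to 3 / c, which the constraint theta c < 3 excludes.
     Half of it is taken, and the coefficient 2 / 3 in the hypothesis, instead of 1 / 3,
     compensates. *)
  exists (3 / (2 * c)); split; first by rewrite divr_ge0// mulr_ge0// ltW.
    have -> : 3 / (2 * c) * c = 3 / 2 :> R by field; rewrite gt_eqF.
    by lra.
  rewrite mul0r add0r lerN2.
  apply: le_trans (ler_wpM2l _ rL); last by rewrite divr_ge0// mulr_ge0// ltW.
  by rewrite le_eqVlt; apply/orP; left; apply/eqP; field; rewrite gt_eqF.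
have vp : 0 < v by rewrite lt0r vN0.
pose s := Num.sqrt (2 * L / v); have sp : 0 < s by rewrite sqrtr_gt0 divr_gt0// mulr_gt0.
have s2 : s ^+ 2 = 2 * L / v by rewrite sqr_sqrtr// ltW// divr_gt0// mulr_gt0.
have sE : Num.sqrt (2 * v * L) = v * s.
  rewrite -[RHS]ger0_norm ?mulr_ge0 ?(ltW sp)// -sqrtr_sqr exprMn s2.
  by congr Num.sqrt; field.
have LE : L = v * s ^+ 2 / 2 by rewrite s2; field.
have qp : 0 < 1 + c * s / 3 by rewrite ltr_wpDr// divr_ge0// mulr_ge0// ltW.
have csp : 0 < c * s by rewrite mulr_gt0.
exists (s / (1 + c * s / 3)); split; first by rewrite divr_ge0// ltW.
  by rewrite mulrAC ltr_pdivrMr// mulrDr mulr1; lra.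
have -> : 1 - s / (1 + c * s / 3) * c / 3 = (1 + c * s / 3)^-1.
  by field; rewrite gt_eqF//; lra.
rewrite sE in rL; have r' : v * s + c * L / 3 <= r.
  by apply: le_trans rL; rewrite lerD2l; have := mulr_gt0 c0 L0; lra.
apply: (@le_trans _ _ (v * ((s / (1 + c * s / 3)) ^+ 2 / (2 * (1 + c * s / 3)^-1)) -
  s / (1 + c * s / 3) * (v * s + c * L / 3))).
  by rewrite lerD2l lerN2 ler_wpM2l// divr_ge0// ltW.
rewrite le_eqVlt; apply/orP; left; apply/eqP; rewrite LE.
by field; rewrite gt_eqF//; lra.
Qed.

(** * Pinelis' inequality for products of finite laws *)

Section InnerProduct.
Context {R : realType} {V : lmodType R} (D : {dot V for idfun}).
Implicit Types x y : V.

Definition dotnorm x := Num.sqrt (D x x).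

Lemma dotC x y : D x y = D y x.
Proof. by rewrite [LHS]hermC expr0 mul1r. Qed.

Lemma dot_suml (I : finType) (F : I -> V) y : D (\sum_i F i) y = \sum_i D (F i) y.
Proof. by rewrite dotC linear_sumr; apply: eq_bigr => i _; exact: dotC. Qed.

Lemma dot_ge0 x : 0 <= D x x.
Proof.
by have [->|/neq0_dnorm_gt0 /ltW//] := eqVneq x 0; rewrite linear0r.
Qed.

Lemma dotnorm_ge0 x : 0 <= dotnorm x. Proof. exact: sqrtr_ge0. Qed.

Lemma sqr_dotnorm x : dotnorm x ^+ 2 = D x x.
Proof. by rewrite sqr_sqrtr// dot_ge0. Qed.

Lemma sqr_dotnormD x y : dotnorm (x + y) ^+ 2 = dotnorm x ^+ 2 + 2 * D x y + dotnorm y ^+ 2.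
Proof. by rewrite !sqr_dotnorm linearDl/= !linearDr/= (dotC y x); ring. Qed.

Lemma dot_cauchy_schwarz x y : `|D x y| <= dotnorm x * dotnorm y.
Proof.
suff H u v : D u v <= dotnorm u * dotnorm v.
  rewrite ler_norml H andbT lerNl.
  have := H (- x) y; rewrite linearNl/= => /le_trans; apply.
  by rewrite /dotnorm linearNl/= linearNr opprK.
have [->|u0] := eqVneq u 0.
  by rewrite linear0l mulr_ge0// dotnorm_ge0.
have u2 : 0 < dotnorm u ^+ 2 by rewrite sqr_dotnorm neq0_dnorm_gt0.
apply: le_trans (ler_norm _) _.
rewrite -(ler_pXn2r (n := 2))// ?nnegrE ?mulr_ge0 ?dotnorm_ge0//.
rewrite real_normK ?num_real// exprMn.
have := dot_ge0 (dotnorm u ^+ 2 *: v - D u v *: u).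
rewrite -sqr_dotnorm sqr_dotnormD !sqr_dotnorm !(linearNl, linearNr)/= !opprK.
rewrite !(linearZl_LR, linearZr_LR)/= (dotC v u) -!sqr_dotnorm => H.
suff : 0 <= dotnorm u ^+ 2 * (dotnorm u ^+ 2 * dotnorm v ^+ 2 - D u v ^+ 2).
  by rewrite pmulr_rge0// subr_ge0.
by apply: le_trans H _; rewrite le_eqVlt; apply/orP; left; apply/eqP; rewrite /GRing.scale/=; ring.
Qed.

Lemma ler_dotnormD x y : dotnorm (x + y) <= dotnorm x + dotnorm y.
Proof.
rewrite -(ler_pXn2r (n := 2))// ?nnegrE ?addr_ge0 ?dotnorm_ge0//.
rewrite sqr_dotnormD sqrrD mulr_natl lerD2r lerD2l ler_pMn2r//.
by rewrite (le_trans (ler_norm _))// dot_cauchy_schwarz.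
Qed.

Lemma dotnormZ a x : dotnorm (a *: x) = `|a| * dotnorm x.
Proof.
rewrite /dotnorm linearZl_LR linearZr_LR/= /GRing.scale/= mulrA -expr2.
by rewrite sqrtrM ?sqr_ge0// sqrtr_sqr.
Qed.

Lemma dotnormN x : dotnorm (- x) = dotnorm x.
Proof. by rewrite -scaleN1r dotnormZ normrN1 mul1r. Qed.

Lemma ler_dotnorm_sum (I : finType) (F : I -> V) :
  dotnorm (\sum_i F i) <= \sum_i dotnorm (F i).
Proof.
elim/big_ind2: _ => [|x a y b xa yb|//].
  by rewrite /dotnorm linear0l sqrtr0.
exact: le_trans (ler_dotnormD _ _) (lerD xa yb).
Qed.

End InnerProduct.

Section Pinelis.
Context {R : realType} {V : lmodType R} (D : {dot V for idfun}) {T : finType}.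
Variables (p : T -> R) (z : T -> V) (c theta : R).
Hypothesis p_ge0 : forall x, 0 <= p x.
Hypothesis p_sum1 : \sum_x p x = 1.
Hypothesis z_centered : \sum_x p x *: z x = 0.
Hypothesis z_bounded : forall x, dotnorm D (z x) <= c.
Hypothesis theta_ge0 : 0 <= theta.
Hypothesis theta_small : theta * c < 3.

Let psi := theta ^+ 2 / (2 * (1 - theta * c / 3)).
Let var := \sum_x p x * dotnorm D (z x) ^+ 2.

(** [cosh_le_tangent] is applied for each x. Its linear term is a multiple of [D s (z x)] and
    averages to zero by centering; its remainder is at most cosh (theta |s|) psi |z x|^2 by
    [expR_bernstein]. *)
Lemma pinelis_step s :
  \sum_x p x * cosh (theta * dotnorm D (s + z x)) <=
  cosh (theta * dotnorm D s) * (1 + psi * var).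
Proof.
pose a := theta * dotnorm D s.
have H x : cosh (theta * dotnorm D (s + z x)) <= cosh a +
    sinh a / a * (theta ^+ 2 * D s (z x)) + cosh a * (psi * dotnorm D (z x) ^+ 2).
  have b0 : 0 <= theta * dotnorm D (z x) by rewrite mulr_ge0// dotnorm_ge0.
  have a0 : 0 <= a by rewrite mulr_ge0// dotnorm_ge0.
  apply: le_trans (cosh_le_tangent (t := theta ^+ 2 * D s (z x)) a0 b0 _ _) _.
  - rewrite normrM (ger0_norm (sqr_ge0 _)) /a mulrACA -expr2.
    by rewrite ler_wpM2l ?sqr_ge0// dot_cauchy_schwarz.
  - by rewrite exprMn sqr_dotnormD /a; ring.
  rewrite lerD2l ler_wpM2l//; first exact: le_trans (cosh_ge1 _).
  have bc : theta * dotnorm D (z x) <= theta * c by rewrite ler_wpM2l.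
  apply: le_trans (expR_bernstein _) _; first by rewrite b0 (le_lt_trans bc).
  rewrite exprMn /psi [leRHS]mulrAC ler_wpM2l ?mulr_ge0 ?dotnorm_ge0//.
  move: bc theta_small; move: (theta * dotnorm _ _) (theta * c) => X Y bc Y3.
  by rewrite lef_pV2 ?posrE; lra.
apply: (@le_trans _ _ (\sum_x p x * (cosh a +
    sinh a / a * (theta ^+ 2 * D s (z x)) + cosh a * (psi * dotnorm D (z x) ^+ 2)))).
  by apply: ler_sum => x _; rewrite ler_wpM2l.
rewrite le_eqVlt; apply/orP; left; apply/eqP.
have -> : \sum_x p x * (cosh a + sinh a / a * (theta ^+ 2 * D s (z x)) +
    cosh a * (psi * dotnorm D (z x) ^+ 2)) =
  cosh a * (\sum_x p x) + sinh a / a * theta ^+ 2 * D s (\sum_x p x *: z x) +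
    cosh a * psi * var.
  have -> : D s (\sum_x p x *: z x) = \sum_x p x * D s (z x).
    by rewrite linear_sumr/=; apply: eq_bigr => x _; rewrite linearZr_LR.
  by rewrite /var !mulr_sumr -!big_split/=; apply: eq_bigr => x _; ring.
by rewrite p_sum1 z_centered linear0r -/a; ring.
Qed.

End Pinelis.

(* The K-fold power of [T], nested to the left: a sum over it is an iterated sum
   that peels off the last coordinate. *)
Fixpoint hist (T : finType) (K : nat) : finType :=
  if K is K'.+1 then (hist T K' * T)%type : finType else unit : finType.

Section Histories.
Context {R : realType} {T : finType}.
Variable p : T -> R.

Fixpoint hist_prod K : hist T K -> R :=
  if K is K'.+1 then fun h => hist_prod h.1 * p h.2 else fun=> 1.

Fixpoint hist_sum (V : nmodType) (z : T -> V) K : hist T K -> V :=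
  if K is K'.+1 then fun h => hist_sum z h.1 + z h.2 else fun=> 0.

Hypothesis p_ge0 : forall x, 0 <= p x.
Hypothesis p_sum1 : \sum_x p x = 1.

Lemma hist_prod_ge0 K (h : hist T K) : 0 <= hist_prod h.
Proof. by elim: K h => //= K IH h; rewrite mulr_ge0. Qed.

Lemma big_hist0 (F : hist T 0 -> R) : \sum_h F h = F tt.
Proof. by rewrite (big_pred1 tt)// => -[]. Qed.

Lemma big_histS K (F : hist T K.+1 -> R) :
  \sum_h F h = \sum_(h : hist T K) \sum_x F (h, x).
Proof. by rewrite pair_big/=; apply: eq_bigr => -[]. Qed.

Lemma hist_prod_sum1 K : \sum_(h : hist T K) hist_prod h = 1.
Proof.
elim: K => [|K IH]; first by rewrite big_hist0.
rewrite big_histS/= -[RHS]IH; apply: eq_bigr => h _.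
by rewrite -mulr_sumr p_sum1 mulr1.
Qed.

(** Telescoping over the last coordinate: |P (h, x) - Q h p x| <= |P (h, x) - P h p x| + p x |P h -
    Q h| with Q the product law, and p sums to 1. The first coordinate is free, which leaves K - 1
    steps. *)
Lemma hist_tv (P : forall K, hist T K -> R) (b : R) K :
  (forall x, P 1%N (tt, x) = p x) ->
  (forall j, (0 < j < K)%N ->
     \sum_(h : hist T j) \sum_x `|P j.+1 (h, x) - P j h * p x| <= b) ->
  (0 < K)%N ->
  \sum_(h : hist T K) `|P K h - hist_prod h| <= b *+ K.-1.
Proof.
move=> P1; case: K => // K; elim: K => [_|K IH step] _.
  rewrite big_histS big_hist0 mulr0n big1// => x _ /=.
  by rewrite P1 mul1r subrr normr0.
rewrite big_histS mulrSr [leRHS]addrC.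
apply: (@le_trans _ _ (\sum_(h : hist T K.+1) (\sum_x
    `|P K.+2 (h, x) - P K.+1 h * p x| + `|P K.+1 h - hist_prod h|))).
  apply: ler_sum => h _; rewrite -[X in _ + X]mulr1 -p_sum1 mulr_sumr -big_split/=.
  apply: ler_sum => x _; rewrite -{3}(ger0_norm (p_ge0 x)) -normrM mulrBl.
  by apply: le_trans (ler_normD _ _); rewrite subrKA.
rewrite big_split/= lerD//; first by apply: (step K.+1); rewrite /= ltnSn.
by apply: IH => // j /andP[j0 jK]; apply: step; rewrite j0 ltnS ltnW.
Qed.

End Histories.

Section TotalVariation.
Context {R : realType} {T : finType}.

(** P and Q have equal mass, so F may be replaced by F - 1, which lies in [-1, 1]. The cost is thus
    the l1 distance itself, although F ranges up to 2. *)
Lemma expectation_tv (P Q F : T -> R) :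
  \sum_x P x = \sum_x Q x -> (forall x, 0 <= F x <= 2) ->
  \sum_x P x * F x <= \sum_x Q x * F x + \sum_x `|P x - Q x|.
Proof.
move=> PQ F02; rewrite -subr_ge0.
have -> : \sum_x Q x * F x + \sum_x `|P x - Q x| - \sum_x P x * F x =
    \sum_x (`|P x - Q x| - (P x - Q x) * (F x - 1)).
  have e : \sum_x (P x - Q x) = 0 by rewrite sumrB PQ subrr.
  rewrite -[LHS]addr0 -[X in _ + X = _]e -sumrN -!big_split/=.
  by apply: eq_bigr => x _; ring.
apply: sumr_ge0 => x _; rewrite subr_ge0 (le_trans (ler_norm _))// normrM.
by rewrite ler_piMr// ler_norml; have /andP[? ?] := F02 x; apply/andP; split; lra.
Qed.

End TotalVariation.

Section BlockExpectation.
Context {R : realType} {V : lmodType R} (D : {dot V for idfun}) {T : finType}.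
Variables (p : T -> R) (z : T -> V) (c theta : R).
Hypothesis p_ge0 : forall x, 0 <= p x.
Hypothesis p_sum1 : \sum_x p x = 1.
Hypothesis z_centered : \sum_x p x *: z x = 0.
Hypothesis z_bounded : forall x, dotnorm D (z x) <= c.
Hypothesis theta_ge0 : 0 <= theta.
Hypothesis theta_small : theta * c < 3.

Let psi := theta ^+ 2 / (2 * (1 - theta * c / 3)).
Let var := \sum_x p x * dotnorm D (z x) ^+ 2.

Lemma pinelis_cosh K :
  \sum_(h : hist T K) hist_prod p h * cosh (theta * dotnorm D (hist_sum z h)) <=
  expR (K%:R * (psi * var)).
Proof.
rewrite expRM_natl; elim: K => [|K IH].
  by rewrite big_hist0/= expr0 mul1r /dotnorm linear0r sqrtr0 mulr0 /cosh oppr0 expR0; lra.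
rewrite big_histS exprSr.
have e0 : 0 <= expR (psi * var) by exact: expR_ge0.
apply: le_trans (ler_wpM2r e0 IH); rewrite mulr_suml; apply: ler_sum => h _ /=.
under eq_bigr do rewrite -mulrA.
rewrite -mulr_sumr -[leRHS]mulrA ler_wpM2l ?hist_prod_ge0//.
apply: (le_trans (pinelis_step p_ge0 p_sum1 z_centered z_bounded theta_ge0 theta_small _)).
by rewrite ler_wpM2l ?expR_ge1Dx//; exact: le_trans (cosh_ge1 _).
Qed.

(** The truncation at 2 makes the change of law affordable. Under the product law it is dropped, and
    e^u <= 2 cosh u leads to [pinelis_cosh]. *)
Lemma block_expectation K (P : hist T K -> R) (C b : R) : 0 <= C ->
  \sum_h P h = 1 -> \sum_h `|P h - hist_prod p h| <= b ->
  \sum_h P h * Num.min 2 (C * expR (theta * dotnorm D (hist_sum z h))) <=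
  2 * C * expR (K%:R * (psi * var)) + b.
Proof.
move=> C0 P1 Pb; apply: le_trans (expectation_tv (Q := @hist_prod _ _ p K) _ _) _.
- by rewrite P1 hist_prod_sum1.
- by move=> h; rewrite le_min ge_min lexx/= andbT ?mulr_ge0 ?expR_ge0// ler0n.
rewrite lerD//; apply: le_trans (ler_wpM2l _ (pinelis_cosh K)); last by rewrite mulr_ge0.
rewrite mulr_sumr; apply: ler_sum => h _; rewrite mulrCA ler_wpM2l ?hist_prod_ge0//.
rewrite ge_min; apply/orP; right.
by rewrite -mulrA [leRHS]mulrCA ler_wpM2l// expR_le_cosh.
Qed.

End BlockExpectation.

(** * Finite-valued random variables *)

Section FiniteValued.
Context {d} {O : measurableType d}.
Implicit Types T A : finType.

(** Measurability is imposed on fibers, so finite types carry no sigma-field. The domain may be a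
    [g_sigma_algebraType], which later expresses measurability with respect to the past or the
    future of the process. *)
Definition finite_measurable T (g : O -> T) := forall x, measurable (g @^-1` [set x]).

Lemma finite_measurable_preimage T (g : O -> T) (B : set T) :
  finite_measurable g -> measurable (g @^-1` B).
Proof.
move=> mg; have -> : g @^-1` B = \bigcup_(x in B) g @^-1` [set x].
  by apply/seteqP; split => [w Bw|w [x Bx /= ->]//]; exists (g w).
by apply: fin_bigcup_measurable => [|x _]; [exact: finite_finset|exact: mg].
Qed.

Lemma finite_measurable_comp T A (g : O -> T) (q : T -> A) :
  finite_measurable g -> finite_measurable (q \o g).
Proof. by move=> mg x; rewrite comp_preimage; exact: finite_measurable_preimage. Qed.

Lemma finite_measurable_fun T d' (O' : measurableType d') (g : O -> T) (F : T -> O') :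
  finite_measurable g -> measurable_fun setT (fun w => F (g w)).
Proof.
by move=> mg _ Y _; rewrite setTI; exact: (finite_measurable_preimage (F @^-1` Y) mg).
Qed.

Lemma finite_measurable_pair T A (g : O -> T) (g' : O -> A) :
  finite_measurable g -> finite_measurable g' ->
  finite_measurable (fun w => (g w, g' w)).
Proof.
move=> mg mg' [x y]; have -> : (fun w => (g w, g' w)) @^-1` [set (x, y)] =
    g @^-1` [set x] `&` g' @^-1` [set y].
  by apply/seteqP; split => [w [<- <-]|w [/= -> ->]].
exact: measurableI.
Qed.

Lemma finite_measurable_tuple A m (g : 'I_m -> O -> A) :
  (forall i, finite_measurable (g i)) ->
  finite_measurable (fun w => [tuple g i w | i < m]).
Proof.
move=> mg x; have -> : (fun w => [tuple g i w | i < m]) @^-1` [set x] =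
    \bigcap_(i in [set: 'I_m]) (g i @^-1` [set tnth x i]).
  apply/seteqP; split => [w /= <- i _ /=|w H]; first by rewrite tnth_mktuple.
  by apply/eq_from_tnth => i; rewrite tnth_mktuple; exact: H.
by apply: fin_bigcap_measurable => [|i _]; [exact: finite_finset|exact: mg].
Qed.

End FiniteValued.

Section FiniteLaw.
Context {d} {Om : measurableType d} {R : realType} (Pr : probability Om R).
Implicit Types T A : finType.

Definition law T (g : Om -> T) (x : T) : R := fine (Pr (g @^-1` [set x])).

Lemma law_ge0 T (g : Om -> T) x : 0 <= law g x.
Proof. exact: fine_ge0. Qed.

Lemma Rintegral_indic (B : set Om) : measurable B -> \int[Pr]_w \1_B w = fine (Pr B).
Proof. by move=> mB; rewrite /Rintegral integral_indic// setIT. Qed.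

Lemma integrable_indic (B : set Om) : measurable B -> Pr.-integrable setT (EFin \o \1_B).
Proof.
move=> mB; apply: measurable_bounded_integrable => //.
- by rewrite (le_lt_trans (probability_le1 _ _)) ?ltey.
- exists 1; split => // x x1 w _ /=; rewrite indicE ger0_norm// (le_trans _ (ltW x1))//.
  by rewrite lern1 leq_b1.
Qed.

Lemma Rintegral_finite T (g : Om -> T) (F : T -> R) : finite_measurable g ->
  \int[Pr]_w F (g w) = \sum_x law g x * F x.
Proof.
move=> mg.
have I x : Pr.-integrable setT (fun w => (F x * \1_(g @^-1` [set x]) w)%:E).
  under eq_fun do rewrite EFinM.
  by apply: integrableZl => //; exact: integrable_indic.
have -> : \int[Pr]_w F (g w) = fine (\int[Pr]_w (\sum_x (F x * \1_(g @^-1` [set x]) w)%:E)%E).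
  congr fine; apply: eq_integral => w _; rewrite sumEFin; congr EFin.
  rewrite (bigD1 (g w))//= indicE mem_set//= mulr1 big1 ?addr0// => x xg.
  by rewrite indicE memNset ?mulr0//= => /esym/eqP; rewrite (negbTE xg).
rewrite integral_sum// -sum_fine => [|x _]; last exact: integrable_fin_num.
apply: eq_bigr => x _; rewrite -[LHS]/(\int[Pr]_w (F x * \1_(g @^-1` [set x]) w)).
by rewrite RintegralZl ?integrable_indic// Rintegral_indic// mulrC.
Qed.

Lemma law_sum1 T (g : Om -> T) : finite_measurable g -> \sum_x law g x = 1.
Proof.
move=> mg; under eq_bigr do rewrite -[law _ _]mulr1.
rewrite -(Rintegral_finite (fun=> 1))// Rintegral_cst// mul1r.
by rewrite [X in fine X](@probability_setT _ _ _ Pr).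
Qed.

Lemma law_comp T A (g : Om -> T) (q : T -> A) a : finite_measurable g ->
  law (q \o g) a = \sum_(x | q x == a) law g x.
Proof.
move=> mg; rewrite {1}/law -Rintegral_indic; last exact: (finite_measurable_comp q mg).
have -> : \1_((q \o g) @^-1` [set a]) = (fun w => (q (g w) == a)%:R) :> (Om -> R).
  apply/funext => w; rewrite indicE; congr (_%:R); congr nat_of_bool.
  by apply/idP/eqP; rewrite inE.
rewrite (Rintegral_finite (fun x => (q x == a)%:R))// [RHS]big_mkcond/=.
by apply: eq_bigr => x _; case: ifP; rewrite ?mulr1 ?mulr0.
Qed.

Lemma law_comp_sum (V : lmodType R) T A (g : Om -> T) (q : T -> A) (F : A -> V) :
  finite_measurable g ->
  \sum_a law (q \o g) a *: F a = \sum_x law g x *: F (q x).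
Proof.
move=> mg; rewrite [RHS](partition_big q xpredT)//=; apply: eq_bigr => a _.
by rewrite law_comp// scaler_suml; apply: eq_bigr => x /eqP ->.
Qed.

End FiniteLaw.

(** * Mixing coefficients tested by finite-valued variables *)

Section BetaFinite.
Context {d} {Om : measurableType d} {R : realType} (Pr : probability Om R).

(** [partition] demands nonempty cells, so only attained values index the family; they are
    enumerated by ordinals to fit [beta_coef]. *)
Lemma partition_fibers {T : finType} (g : Om -> T) :
  let E := [set x | `[< (g @^-1` [set x]) !=set0 >]]%SET in
  partition setT (fun i : 'I_#|E| => g @^-1` [set enum_val i]) setT.
Proof.
move=> E; split.
- apply/seteqP; split => // w _.
  have gE : g w \in E by rewrite inE; apply/asboolP; exists w.
  by exists (enum_rank_in gE (g w)) => //=; rewrite enum_rankK_in.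
- by move=> i j _ _ [w /= [-> /enum_val_inj]].
- by move=> i _; have := enum_valP i; rewrite inE => /asboolP.
Qed.

Lemma sum_fibers {T : finType} (g : Om -> T) (F : T -> R) :
  (forall x, g @^-1` [set x] = set0 -> F x = 0) ->
  let E := [set x | `[< (g @^-1` [set x]) !=set0 >]]%SET in
  \sum_(i < #|E|) F (enum_val i) = \sum_x F x.
Proof.
move=> F0 E; rewrite -(big_enum_val F) /= big_mkcond/=.
apply: eq_bigr => x _; case: ifPn => //; rewrite inE => /asboolPn nE.
by apply/esym/F0; apply: contrapT => /eqP/set0P.
Qed.

(** The fibers of g and g' form an admissible pair of partitions in the supremum, and values that
    are never attained contribute zero. The factor 2 undoes the 1 / 2 in [beta_coef]. *)
Lemma beta_coef_finite {T T' : finType} (G G' : set_system Om) (g : Om -> T) (g' : Om -> T') b :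
  (forall x, G (g @^-1` [set x])) -> (forall x, G' (g' @^-1` [set x])) ->
  (beta_coef Pr G G' <= b%:E)%E ->
  \sum_x \sum_y `|law Pr (fun w => (g w, g' w)) (x, y) - law Pr g x * law Pr g' y| <= 2 * b.
Proof.
move=> Gg Gg' Gb; rewrite -ler_pdivrMl// -lee_fin; apply: le_trans Gb.
apply: ereal_sup_ubound.
pose E := [set x | `[< (g @^-1` [set x]) !=set0 >]]%SET.
pose E' := [set x | `[< (g' @^-1` [set x]) !=set0 >]]%SET.
exists #|E|, #|E'|, (fun i => g @^-1` [set enum_val i]), (fun i => g' @^-1` [set enum_val i]).
split => //; [exact: partition_fibers|exact: partition_fibers|].
congr (EFin (_ * _)).
have L x y : law Pr (fun w => (g w, g' w)) (x, y) =
    fine (Pr (g @^-1` [set x] `&` g' @^-1` [set y])).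
  congr (fine (Pr _)); apply/seteqP; split => [w [<- <-]|w [/= -> ->]] //.
under eq_bigr do under eq_bigr do rewrite L.
pose F x y := `|fine (Pr (g @^-1` [set x] `&` g' @^-1` [set y])) - law Pr g x * law Pr g' y|.
rewrite -(@sum_fibers _ g (fun x => \sum_y F x y)) => [|x x0]; last first.
  by rewrite big1// => y _; rewrite /F /law x0 set0I measure0 mul0r subrr normr0.
apply: eq_bigr => i _; rewrite -(@sum_fibers _ g' (F _))// => y y0.
by rewrite /F /law y0 setI0 measure0 mulr0 subrr normr0.
Qed.

End BetaFinite.

(** * Blocks of a finite-valued stationary process *)

Section Blocks.
Context {d d'} {Om : measurableType d} {S : measurableType d'} {R : realType}.
Variables (Pr : probability Om R) (X : nat -> {RV Pr >-> S}).
Context {A : finType} (f : S -> A) (tau : nat).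
Hypothesis f_meas : finite_measurable f.
Hypothesis X_stationary : stationary X.

Definition block (s : nat) (w : Om) : tau.-tuple A := [tuple f (X (s + i)%N w) | i < tau].

(* [parity_blocks e K] collects the blocks of index [2 j + e], [j < K]. *)
Fixpoint parity_blocks (e K : nat) : Om -> hist (tau.-tuple A) K :=
  if K is K'.+1 then fun w => (parity_blocks e K' w, block ((K'.*2 + e) * tau) w)
  else fun=> tt.

Lemma sigma_process_finite (I : set nat) t x : I t ->
  sigma_process X I ((f \o X t) @^-1` [set x]).
Proof.
move=> It; apply: sub_sigma_algebra; exists t => //.
by exists (f @^-1` [set x]); [exact: f_meas|rewrite setTI].
Qed.

Lemma block_sigma_process (I : set nat) s :
  (forall i, (i < tau)%N -> I (s + i)%N) ->
  @finite_measurable _ (g_sigma_algebraType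
    (\bigcup_(t in I) preimage_set_system setT (X t) measurable)) _ (block s).
Proof.
by move=> Is; apply: finite_measurable_tuple => i x; apply: sigma_process_finite; exact: Is.
Qed.

(** The last of the K blocks has index 2 (K - 1) + e, so the history ends just before time (2 K + e
    - 1) tau. *)
Lemma parity_blocks_sigma_process (I : set nat) e K :
  (forall t, (t < (K.*2 + e).-1 * tau)%N -> I t) ->
  @finite_measurable _ (g_sigma_algebraType
    (\bigcup_(t in I) preimage_set_system setT (X t) measurable)) _ (parity_blocks e K).
Proof.
elim: K => [|K IH] IK /=.
  move=> x; case: x; rewrite (_ : _ @^-1` _ = setT); last by apply/seteqP; split => // w _ /=.
  exact: (@measurableT _ (g_sigma_algebraType _)).
apply: finite_measurable_pair.
  apply: IH => t /leq_trans tK; apply: IK; apply: tK.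
  by rewrite leq_mul2r doubleS/= (leq_trans (leq_pred _)) ?orbT// leqW.
apply: block_sigma_process => i itau; apply: IK.
by rewrite doubleS/= mulSn addnC ltn_add2r.
Qed.

Lemma block_measurable s : finite_measurable (block s).
Proof.
apply: finite_measurable_tuple => i x; rewrite comp_preimage -[X in measurable X]setTI.
exact: measurable_funPT.
Qed.

Lemma parity_blocks_measurable e K : finite_measurable (parity_blocks e K).
Proof.
elim: K => [|K IH] /=; last exact: finite_measurable_pair IH (block_measurable _).
move=> [] /=; rewrite (_ : _ @^-1` _ = setT)//; by apply/seteqP; split => // w _ /=.
Qed.

Lemma law_block_stationary s x : law Pr (block s) x = law Pr (block 0) x.
Proof.
pose B := [set y : tau.-tuple S | [tuple f (tnth y i) | i < tau] = x].
have mB : measurable B.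
  apply: (@finite_measurable_tuple _ _ _ _ (fun i y => f (tnth y i))) => i a.
  rewrite (_ : _ @^-1` _ = (@tnth _ S ^~ i) @^-1` (f @^-1` [set a]))//.
  by rewrite -[X in measurable X]setTI; apply: measurable_tnth => //; exact: f_meas.
have BE h w : [tuple f (tnth [tuple X (h + i)%N w | i < tau] i) | i < tau] = block h w.
  by apply/eq_from_tnth => i; rewrite !tnth_mktuple.
have E h : block h @^-1` [set x] = [set w | B [tuple X (h + i)%N w | i < tau]].
  by apply/seteqP; split => w; rewrite /B /= BE.
by rewrite /law !E X_stationary//.
Qed.

(** Successive blocks of one parity are separated by a skipped block of length tau, so each step of
    [hist_tv] costs 2 beta(tau); stationarity makes all block laws equal. *)
Lemma parity_blocks_tv (b : R) e K : (beta_mix X tau <= b%:E)%E -> (0 < K)%N ->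
  \sum_h `|law Pr (parity_blocks e K) h - hist_prod (law Pr (block 0)) h| <= 2 * b *+ K.-1.
Proof.
move=> Xb K0.
apply: (@hist_tv _ _ _ (law_ge0 _ _) (law_sum1 _ (block_measurable 0))
  (fun K => law Pr (parity_blocks e K))) => //.
  move=> x; rewrite -(law_block_stationary (e * tau)); congr (fine (Pr _)).
  by apply/seteqP; split => [w [<-]|w /= <-].
move=> j /andP[j0 _].
have -> : law Pr (block 0) = law Pr (block ((j.*2 + e) * tau)).
  by apply/funext => x; rewrite law_block_stationary.
(* For tau > 0 this is the last time seen by the first j blocks. The next block starts at r + 1 +
   tau, hence within the future from r + tau on. *)
pose r := ((j.*2 + e).-1 * tau).-1.
apply: (@beta_coef_finite _ _ _ _ _ _ (sigma_process X [set t | (t <= r)%N])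
    (sigma_process X [set t | (r + tau <= t)%N])).
- move=> x; apply: parity_blocks_sigma_process => t /=.
  by case: (_ * tau)%N @r => //= n; rewrite ltnS.
- move=> x; apply: block_sigma_process => i itau /=.
  rewrite (leq_trans _ (leq_addr _ _))// -[X in (X * _)%N]prednK ?mulSn; last first.
    by rewrite addn_gt0 double_gt0 j0.
  by rewrite addnC leq_add2l leq_pred.
- apply: le_trans Xb; apply: ereal_sup_ubound; by exists r.
Qed.

(** By induction on m: the block of index m joins the class of its parity. There are [uphalf m] even
    and [m./2] odd indices below m. *)
Lemma block_big_split (V : zmodType) (F : A -> V) m w :
  \sum_(t < m * tau) F (f (X t w)) =
  hist_sum (fun x : tau.-tuple A => \sum_i F (tnth x i)) (parity_blocks 0 (uphalf m) w) +
  hist_sum (fun x : tau.-tuple A => \sum_i F (tnth x i)) (parity_blocks 1 m./2 w).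
Proof.
rewrite -(big_mkord xpredT (fun t => F (f (X t w)))); elim: m => [|m IH].
  by rewrite mul0n big_geq//= addr0.
have E : \sum_(i < tau) F (tnth (block (m * tau) w) i) =
    \sum_(m * tau <= t < m.+1 * tau) F (f (X t w)).
  rewrite mulSn -{2}[(m * tau)%N]add0n big_addn addnK big_mkord.
  by apply: eq_bigr => i _; rewrite tnth_mktuple addnC.
rewrite (big_cat_nat (n := (m * tau)%N))//=; last by rewrite leq_mul2r leqnSn orbT.
rewrite IH -E uphalf_half; case: (boolP (odd m)) => [mo|me] /=.
  have e : (m = (m./2.*2 + 1)%N) by rewrite -{1}(odd_double_half m) mo addnC.
  by rewrite !add0n -e -addrA.
have e : (m = m./2.*2) by rewrite -{1}(odd_double_half m) (negbTE me).
by rewrite !add0n addn0 -e addrAC.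
Qed.

End Blocks.

(** * Concentration for a finite-valued process *)

Section FiniteConcentration.
Context {d d'} {Om : measurableType d} {S : measurableType d'} {R : realType}.
Variables (Pr : probability Om R) (X : nat -> {RV Pr >-> S}).
Context {A : finType} (f : S -> A) (tau : nat).
Context {V : lmodType R} (D : {dot V for idfun}) (phi : A -> V).
Hypothesis f_meas : finite_measurable f.
Hypothesis X_stationary : stationary X.

Let p := law Pr (block X f tau 0).
Let mean := \sum_a law Pr (f \o X 0) a *: phi a.
Let z (x : tau.-tuple A) := \sum_i (phi (tnth x i) - mean).
Let var := \sum_x p x * dotnorm D (z x) ^+ 2.

Lemma coordinate_measurable t : finite_measurable (f \o X t).
Proof.
move=> x; rewrite comp_preimage -[X in measurable X]setTI.
exact: measurable_funPT.
Qed.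

(** A single observation is a block of length 1. *)
Lemma law_stationary t a : law Pr (f \o X t) a = law Pr (f \o X 0) a.
Proof.
have H s : law Pr (f \o X s) a = law Pr (block X f 1 s) [tuple a].
  congr (fine (Pr _)); apply/seteqP; split => w /=.
    by move=> <-; apply/eq_from_tnth => i; rewrite tnth_mktuple ord1 addn0.
  by move=> /(congr1 (fun x => tnth x ord0)); rewrite tnth_mktuple addn0.
by rewrite !H law_block_stationary.
Qed.

Lemma block_centered : \sum_x p x *: z x = 0.
Proof.
have pm : finite_measurable (block X f tau 0) by exact: block_measurable.
under eq_bigr do rewrite scaler_sumr.
rewrite exchange_big big1// => i _.
under eq_bigr do rewrite scalerBr.
rewrite sumrB -scaler_suml law_sum1// scale1r.
rewrite -(@law_comp_sum _ _ _ Pr _ _ _ _ (fun x => tnth x i) phi)//.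
apply/eqP; rewrite subr_eq0; apply/eqP; apply: eq_bigr => a _.
rewrite -(law_stationary i); congr (_ *: _); congr (fine (Pr _)).
by apply/seteqP; split => w /=; rewrite tnth_mktuple add0n.
Qed.

Lemma finite_concentration (kappa c L r b : R) m :
  (forall a, dotnorm D (phi a) <= kappa) -> 2 * tau%:R * kappa <= c -> 0 < c -> 0 < L ->
  2 * Num.sqrt (m%:R * var * L) + 4 / 3 * c * L <= r ->
  (beta_mix X tau <= b%:E)%E -> (1 < m)%N ->
  fine (Pr [set w | r < dotnorm D (\sum_(t < m * tau) (phi (f (X t w)) - mean))]) <=
  2 * expR (- L) + b * (m - 2)%:R.
Proof.
move=> phik kc c0 L0 rL Xb m1.
have pm : finite_measurable (block X f tau 0) by exact: block_measurable.
have p0 x : 0 <= p x by exact: law_ge0.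
have p1 : \sum_x p x = 1 by exact: law_sum1.
have mk : dotnorm D mean <= kappa.
  apply: le_trans (ler_dotnorm_sum _ _) _.
  rewrite -[leRHS]mul1r -(law_sum1 Pr (coordinate_measurable 0)) mulr_suml.
  by apply: ler_sum => a _; rewrite dotnormZ ger0_norm ?law_ge0// ler_wpM2l ?law_ge0.
have zc x : dotnorm D (z x) <= c.
  apply: le_trans (ler_dotnorm_sum _ _) _; apply: le_trans kc.
  rewrite mulrAC mulrC -[in X in _ <= X](card_ord tau) mulr_natl -sumr_const.
  apply: ler_sum => i _; apply: le_trans (ler_dotnormD _ _ _) _.
  by rewrite dotnormN mulr_natl mulr2n lerD.
have var0 : 0 <= var by apply: sumr_ge0 => x _; rewrite mulr_ge0 ?sqr_ge0.
(* Each class gets half of the threshold and is treated as if it had m / 2 blocks. *)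
have v0 : 0 <= m%:R / 2 * var by rewrite mulr_ge0// divr_ge0.
have rL' : Num.sqrt (2 * (m%:R / 2 * var) * L) + 2 / 3 * c * L <= r / 2.
  have -> : 2 * (m%:R / 2 * var) * L = m%:R * var * L by field.
  by lra.
have [theta [th0 thc thL]] := bernstein_parameter v0 c0 L0 rL'.
pose q := theta ^+ 2 / (2 * (1 - theta * c / 3)) * var.
pose KA := uphalf m; pose KB := m./2.
have KAB : (KA + KB = m)%N by rewrite /KA uphalf_half -addnA addnn odd_double_half.
have KA0 : (0 < KA)%N by rewrite /KA; case: (m) m1.
have KB0 : (0 < KB)%N by rewrite /KB half_gt0.
(* [e] balances the two exponential moments when m is odd, i.e. KA = KB + 1. *)
pose e := (KA%:R - KB%:R) / 2 * q.
pose CA := expR (- (theta * r / 2) - e); pose CB := expR (- (theta * r / 2) + e).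
pose FA (h : hist (tau.-tuple A) KA) : R :=
  Num.min 2 (CA * expR (theta * dotnorm D (hist_sum z h))).
pose FB (h : hist (tau.-tuple A) KB) : R :=
  Num.min 2 (CB * expR (theta * dotnorm D (hist_sum z h))).
pose PA := parity_blocks X f tau 0 KA.
pose PB := parity_blocks X f tau 1 KB.
have mA : finite_measurable PA by exact: parity_blocks_measurable.
have mB : finite_measurable PB by exact: parity_blocks_measurable.
have mAB := finite_measurable_pair mA mB.
pose bad (u : hist (tau.-tuple A) KA * hist (tau.-tuple A) KB) :=
  r < dotnorm D (hist_sum z u.1 + hist_sum z u.2).
have -> : [set w | r < dotnorm D (\sum_(t < m * tau) (phi (f (X t w)) - mean))] =
    (bad \o (fun w => (PA w, PB w))) @^-1` [set true].
  apply/seteqP; split => w /=; by rewrite /bad/= (block_big_split X f tau (fun a => phi a - mean)).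
rewrite -/(law Pr _ _) law_comp//.
have EA : \sum_h law Pr PA h * FA h <= 2 * expR (- L) + 2 * b * KA.-1%:R.
  rewrite [2 * b * _]mulr_natr.
  have := @block_expectation _ _ D _ p z c theta p0 p1 block_centered zc th0 thc
    KA (law Pr PA) CA _ (expR_ge0 _) (law_sum1 Pr mA)
    (parity_blocks_tv f_meas X_stationary 0 Xb KA0).
  move/le_trans; apply; rewrite lerD2r -mulrA ler_wpM2l// -expRD ler_expR -/q.
  have : m%:R = KA%:R + KB%:R :> R by rewrite -natrD KAB.
  by move: thL; rewrite -/var (_ : m%:R / 2 * var * _ = m%:R / 2 * q) /e /q; [|ring]; nra.
have EB : \sum_h law Pr PB h * FB h <= 2 * expR (- L) + 2 * b * KB.-1%:R.
  rewrite [2 * b * _]mulr_natr.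
  have := @block_expectation _ _ D _ p z c theta p0 p1 block_centered zc th0 thc
    KB (law Pr PB) CB _ (expR_ge0 _) (law_sum1 Pr mB)
    (parity_blocks_tv f_meas X_stationary 1 Xb KB0).
  move/le_trans; apply; rewrite lerD2r -mulrA ler_wpM2l// -expRD ler_expR -/q.
  have : m%:R = KA%:R + KB%:R :> R by rewrite -natrD KAB.
  by move: thL; rewrite -/var (_ : m%:R / 2 * var * _ = m%:R / 2 * q) /e /q; [|ring]; nra.
(* If a truncated term equals 2, the half-sum is already at least 1. Otherwise the terms are e^x and
   e^y, where the shifts by [e] cancel in x + y and the triangle inequality gives x + y >= 0; then
   e^x + e^y >= 2 + x + y >= 2. *)
have bad_le u : (bad u)%:R <= (FA u.1 + FB u.2) / 2.
  have a0 : 0 <= FA u.1 by rewrite le_min mulr_ge0 ?expR_ge0// ler0n.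
  have b0 : 0 <= FB u.2 by rewrite le_min mulr_ge0 ?expR_ge0// ler0n.
  case: (boolP (bad u)) => [ru|_]; last by rewrite mulr0n divr_ge0// addr_ge0.
  rewrite ler_pdivlMr// mul1r; have [|A2] := leP 2 (FA u.1); first by lra.
  have [|B2] := leP 2 (FB u.2); first by lra.
  have -> : FA u.1 = CA * expR (theta * dotnorm D (hist_sum z u.1)).
    by move: A2; rewrite /FA gt_min ltxx/= => /ltW/min_idPr.
  have -> : FB u.2 = CB * expR (theta * dotnorm D (hist_sum z u.2)).
    by move: B2; rewrite /FB gt_min ltxx/= => /ltW/min_idPr.
  rewrite -!expRD.
  set x := - (theta * r / 2) - e + _; set y := - (theta * r / 2) + e + _.
  have xy : 0 <= x + y.
    have := ler_dotnormD D (hist_sum z u.1) (hist_sum z u.2).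
    move: (ltW ru) => /le_trans /[apply] /(ler_wpM2l th0); rewrite /x /y; lra.
  have := expR_ge1Dx x; have := expR_ge1Dx y; lra.
apply: (@le_trans _ _ (\sum_u law Pr (fun w => (PA w, PB w)) u * ((FA u.1 + FB u.2) / 2))).
  rewrite big_mkcond/=; apply: ler_sum => u _.
  apply: le_trans (ler_wpM2l (law_ge0 _ _ _) (bad_le u)).
  by rewrite eqb_id; case: ifP => _; rewrite ?mulr1 ?mulr0.
under eq_bigr do rewrite mulrA mulrDr.
rewrite -mulr_suml big_split/=.
rewrite -(@law_comp_sum _ _ _ Pr R^o _ _ _ fst FA)// -(@law_comp_sum _ _ _ Pr R^o _ _ _ snd FB)//.
move: EA EB; rewrite /GRing.scale/= => EA EB.
rewrite ler_pdivrMr//; apply: le_trans (lerD EA EB) _.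
have -> : (m - 2)%:R = KA.-1%:R + KB.-1%:R :> R.
  by rewrite -natrD -KAB; case: (KA) (KB) KA0 KB0 => // x [|y]// _ _; rewrite addnS subn2.
by rewrite le_eqVlt; apply/orP; left; apply/eqP; ring.
Qed.

End FiniteConcentration.

(** * Limits of integrals and the Bochner integral *)

Section BoundedConvergence.
Context {d} {O : measurableType d} {R : realType} (Q : probability O R).

Lemma bounded_integrable (g : O -> R) (C : R) :
  measurable_fun setT g -> (forall x, `|g x| <= C) -> Q.-integrable setT (EFin \o g).
Proof.
move=> mg gC; apply: measurable_bounded_integrable => //.
  by rewrite (le_lt_trans (probability_le1 _ _)) ?ltey.
by exists C; split; rewrite ?num_real// => y Cy x _; rewrite /= (le_trans (gC x))// ltW.
Qed.

Lemma bounded_cvg (g_ : nat -> O -> R) (g : O -> R) (C : R) :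
  (forall n, measurable_fun setT (g_ n)) -> (forall n x, `|g_ n x| <= C) ->
  (forall x, g_ ^~ x @ \oo --> g x) ->
  \int[Q]_x g_ n x @[n --> \oo] --> \int[Q]_x g x.
Proof.
move=> mg gC gg.
have mlim : measurable_fun setT g by apply: measurable_fun_cvg mg _ => x _; exact: gg.
have gC' x : `|g x| <= C.
  have h : `|g_ n x| @[n --> \oo] --> `|g x| by apply: cvg_norm; exact: gg.
  by apply: (cvgr_to_le h); apply: nearW => n; exact: gC.
apply: fine_cvg; rewrite fineK; last first.
  by apply: integrable_fin_num => //; exact: bounded_integrable mlim gC'.
apply: (@dominated_cvg _ _ _ _ _ measurableT _ _ (cst C%:E)) => //.
- by move=> n; apply/measurable_EFinP; exact: mg.
- by move=> x _; apply: cvg_EFin; [exact: nearW|exact: gg].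
- apply: (@bounded_integrable (cst C) `|C|) => //; exact: measurable_cst.
- by move=> n x _ /=; rewrite lee_fin gC.
Qed.

(** The indicators of B and E_n jointly converge pointwise to that of B, so bounded convergence
    applies. It serves strict inequalities between limits, which hold eventually along the
    sequence. *)
Lemma probability_liminf_le (E_ : nat -> set O) (B : set O) (p : R) :
  (forall n, measurable (E_ n)) -> measurable B ->
  (forall n, fine (Q (E_ n)) <= p) ->
  (forall x, B x -> \forall n \near \oo, E_ n x) -> fine (Q B) <= p.
Proof.
move=> mE mB Ep BE.
have mBE n : measurable (B `&` E_ n) by exact: measurableI.
have H : fine (Q (B `&` E_ n)) @[n --> \oo] --> fine (Q B).
  rewrite -(Rintegral_indic _ mB).
  under eq_fun do rewrite -(Rintegral_indic _ (mBE _)).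
  apply: (@bounded_cvg _ _ 1).
  - by move=> n; exact: measurable_indic.
  - by move=> n x; rewrite indicE ger0_norm// lern1 leq_b1.
  move=> x; have [Bx|nBx] := pselect (B x).
    apply: cvg_near_cst; near=> n; rewrite !indicE !mem_set//; split => //.
    by near: n; exact: BE.
  by apply: cvg_near_cst; apply: nearW => n; rewrite !indicE !memNset// => -[].
apply: (cvgr_to_le H); apply: nearW => n; apply: le_trans (Ep n).
apply: fine_le; [exact: fin_num_measure|exact: fin_num_measure|].
exact: (le_measure Q (mem_set (mBE n)) (mem_set (mE n)) (@subIsetr _ _ _)).
Unshelve. all: by end_near.
Qed.

End BoundedConvergence.

Lemma measurable_superlevel {d} {O : measurableType d} {R : realType} (g : O -> R) (a : R) :
  measurable_fun setT g -> measurable [set w | a < g w].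
Proof.
move=> mg; rewrite -[X in measurable X]setTI.
rewrite (_ : [set w | a < g w] = g @^-1` `]a, +oo[); first exact: mg.
by apply/seteqP; split => w /=; rewrite in_itv/= andbT.
Qed.

(** * The Bochner integral as a limit of finite sums *)

Section BochnerLimit.
Context {d} {O : measurableType d} {R : realType} (Q : probability O R).
Context {E : completeNormedModType R}.

Lemma finite_integral_dist {T T' : finType} (g : O -> T) (g' : O -> T')
    (psi : T -> E) (psi' : T' -> E) :
  finite_measurable g -> finite_measurable g' ->
  `|\sum_x law Q g x *: psi x - \sum_y law Q g' y *: psi' y| <=
  \int[Q]_x `|psi (g x) - psi' (g' x)|.
Proof.
move=> mg mg'; have mgg := finite_measurable_pair mg mg'.
rewrite (@law_comp_sum _ _ _ Q _ _ _ _ fst psi mgg) (@law_comp_sum _ _ _ Q _ _ _ _ snd psi' mgg).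
rewrite (Rintegral_finite _ (fun u => `|psi u.1 - psi' u.2|) mgg) -sumrB.
apply: le_trans (ler_norm_sum _ _ _) _; apply: ler_sum => u _.
by rewrite -scalerBr normrZ ger0_norm// law_ge0.
Qed.

Lemma simple_vfun_finite (s : O -> E) : simple_vfun s ->
  exists (T : finType) (g : O -> T) (psi : T -> E),
  [/\ finite_measurable g, s = psi \o g &
      simple_vintegral Q s = \sum_x law Q g x *: psi x].
Proof.
move=> [fs ms]; pose Y := fset_set (range s).
have sY x : s x \in Y by rewrite in_fset_set// mem_set//; exists x.
exists (finmap.fset_sub_type Y), (fun x => finmap.FSetSub (sY x)), val.
have gE y : (fun x => finmap.FSetSub (sY x)) @^-1` [set y] = s @^-1` [set val y].
  by apply/seteqP; split => x /= => [<-//|e]; exact: val_inj.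
split => //; first by move=> y; rewrite gE.
rewrite /simple_vintegral fsbig_finite//= finmap.big_seq_fsetE/=.
by apply: eq_bigr => y _; rewrite /law gE.
Qed.

Lemma finite_simple_vfun {T : finType} (g : O -> T) (psi : T -> E) :
  finite_measurable g -> simple_vfun (psi \o g).
Proof.
move=> mg; split.
  apply: (sub_finite_set (B := range psi)); last exact: finite_image finite_finset.
  by move=> _ [x _ <-]; exists (g x).
by move=> y; rewrite comp_preimage; exact: finite_measurable_preimage.
Qed.

(** Since psi may merge fibers of g, the sum is compared with the one over the values of psi o g:
    the two differ by at most the integral of zero. *)
Lemma finite_simple_vintegral {T : finType} (g : O -> T) (psi : T -> E) :
  finite_measurable g ->
  simple_vintegral Q (psi \o g) = \sum_x law Q g x *: psi x.
Proof.
move=> mg; have [T' [g' [psi' [mg' e ->]]]] := simple_vfun_finite (finite_simple_vfun psi mg).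
apply/eqP; rewrite -subr_eq0 -normr_le0.
apply: le_trans (finite_integral_dist _ _ mg' mg) _.
under eq_Rintegral => x _.
  rewrite (_ : psi' (g' x) = psi (g x)) ?subrr ?normr0; last by rewrite -[LHS]/((psi' \o g') x) -e.
  over.
by rewrite Rintegral_cst// mul0r.
Qed.

(** Measurability of phi is expressed by its distances to fixed vectors, so E carries no
    sigma-field. *)
Variables (phi : O -> E) (phi_meas : forall y, measurable_fun setT (fun x => `|phi x - y|)).

Lemma measurable_dist_finite {T : finType} (g : O -> T) (psi : T -> E) :
  finite_measurable g -> measurable_fun setT (fun x => `|phi x - psi (g x)|).
Proof.
move=> mg _ Y mY; rewrite setTI.
have -> : (fun x => `|phi x - psi (g x)|) @^-1` Y =
    \bigcup_(t in [set: T]) (g @^-1` [set t] `&` (fun x => `|phi x - psi t|) @^-1` Y).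
  by apply/seteqP; split => [x /= Yx|x [t _ [/= -> //]]]; exists (g x).
apply: fin_bigcup_measurable => [|t _]; first exact: finite_finset.
by apply: measurableI => //; rewrite -[X in measurable X]setTI; exact: phi_meas.
Qed.

Lemma simple_vintegral_dist (s s' : O -> E) : simple_vfun s -> simple_vfun s' ->
  (`|simple_vintegral Q s - simple_vintegral Q s'|%:E <=
   \int[Q]_x `|phi x - s x|%:E + \int[Q]_x `|phi x - s' x|%:E)%E.
Proof.
move=> /simple_vfun_finite[T [g [psi [mg -> ->]]]].
move=> /simple_vfun_finite[T' [g' [psi' [mg' -> ->]]]].
have m1 := measurable_dist_finite psi mg.
have m2 := measurable_dist_finite psi' mg'.
rewrite -ge0_integralD//; [|exact/measurable_EFinP|exact/measurable_EFinP].
have mgg := finite_measurable_pair mg mg'.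
have m3 : measurable_fun setT (fun x => `|psi (g x) - psi' (g' x)|).
  exact: (finite_measurable_fun (fun u => `|psi u.1 - psi' u.2|) mgg).
apply: (@le_trans _ _ (\int[Q]_x `|psi (g x) - psi' (g' x)|%:E)%E); last first.
  apply: ge0_le_integral => //.
  - exact/measurable_EFinP.
  - by apply: emeasurable_funD; exact/measurable_EFinP.
  - move=> x _; rewrite -EFinD lee_fin /= [X in _ <= X + _]distrC.
    exact: ler_distD.
apply: le_trans (_ : (\int[Q]_x `|psi (g x) - psi' (g' x)|)%:E <= _)%E.
  by rewrite lee_fin finite_integral_dist.
rewrite /Rintegral fineK//; apply: integrable_fin_num => //.
apply: (@bounded_integrable _ _ _ _ _ (\sum_u `|psi u.1 - psi' u.2|)) => // x.
rewrite normr_id (bigD1 (g x, g' x))//= lerDl; exact: sumr_ge0.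
Qed.

(** [bochner_integral] is a choice by [get], so both existence and uniqueness are at stake.
    [simple_vintegral_dist] makes the integrals of s_ Cauchy, and completeness gives a limit I;
    applied again, it shows that the sequence behind the chosen value has the same limit. *)
Lemma bochner_integral_cvg (s_ : nat -> O -> E) :
  (forall m, simple_vfun (s_ m)) -> (forall x, s_ ^~ x @ \oo --> phi x) ->
  (\int[Q]_x `|phi x - s_ m x|%:E)%E @[m --> \oo] --> 0%E ->
  simple_vintegral Q (s_ m) @[m --> \oo] --> bochner_integral Q phi.
Proof.
move=> ss sphi s0.
have small (u : nat -> O -> E) (e : R) : 0 < e ->
    (\int[Q]_x `|phi x - u m x|%:E)%E @[m --> \oo] --> 0%E ->
    \forall m \near \oo, (\int[Q]_x `|phi x - u m x|%:E < e%:E)%E.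
  move=> e0 /fine_cvgP[ufin /cvgr_lt/(_ _ e0) ue].
  near=> m; rewrite -[X in (X < _)%E]fineK; last by near: m.
  by rewrite lte_fin; near: m.
have /cvg_ex[I sI] : cvg (simple_vintegral Q (s_ m) @[m --> \oo]).
  apply: cauchy_cvg; apply: cauchy_exP => e e0.
  have e2 : 0 < e / 2 by rewrite divr_gt0.
  have [N _ HN] := small _ _ e2 s0.
  exists (simple_vintegral Q (s_ N)); exists N => // m Nm /=.
  rewrite -ball_normE/= -lte_fin; apply: le_lt_trans (simple_vintegral_dist _ _) _ => //.
  by rewrite [e in (_ < e%:E)%E]splitr EFinD; apply: lteD; apply: HN => /=.
have BI : is_bochner_integral Q phi I by exists s_; split => //; exact: aeW.
have [u [us _ u0 uI]] : is_bochner_integral Q phi (bochner_integral Q phi).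
  by apply: getPex; exists I.
suff -> : bochner_integral Q phi = I by [].
apply/eqP; rewrite -subr_eq0 -normr_le0; apply/ler_addgt0Pl => e e0; rewrite addr0.
have uIsI : `|simple_vintegral Q (u m) - simple_vintegral Q (s_ m)| @[m --> \oo]
    --> `|bochner_integral Q phi - I| by apply: cvg_norm; exact: cvgB.
apply: (cvgr_to_le uIsI); near=> m.
rewrite -lee_fin; apply: le_trans (simple_vintegral_dist _ _) _ => //.
rewrite [e in (_ <= e%:E)%E]splitr EFinD; apply: leeD; apply: ltW; near: m.
  by apply: small => //; rewrite divr_gt0.
by apply: small => //; rewrite divr_gt0.
Unshelve. all: by end_near.
Qed.

End BochnerLimit.

(** * Quantization of the feature map *)

Section Feature.
Context {R : realType} {S : ptopologicalType} {k : S -> S -> R} (H : rkhs k).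
Local Notation phi := (rkhs_feature H).
Local Notation dot := (rkhs_dot H).

Lemma rkhs_dotnormE (f : H) : dotnorm dot f = `|f|.
Proof. by rewrite rkhs_normE. Qed.

Lemma feature_dot x y : dot (phi x) (phi y) = k x y.
Proof. by rewrite rkhs_reproducing rkhs_featureE. Qed.

Lemma feature_norm_le x : bounded_kernel k ->
  `|phi x| <= Num.sqrt (sup (range (fun x => k x x))).
Proof.
move=> bk; rewrite rkhs_normE feature_dot ler_wsqrtr//.
apply: ub_le_sup => //; by exists x.
Qed.

Lemma sqr_feature_dist x y : `|phi x - phi y| ^+ 2 = k x x - 2 * k x y + k y y.
Proof.
rewrite -rkhs_dotnormE sqr_dotnormD !sqr_dotnorm !linearNr/= linearNl/= opprK.
by rewrite !feature_dot.
Qed.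

(** The squared distance |phi y - phi x|^2 is an expression in k that is continuous in y and
    vanishes at x. *)
Lemma feature_continuous : continuous (fun p : S * S => k p.1 p.2) -> continuous phi.
Proof.
move=> kc x; apply/subr_cvg0; apply: norm_cvg0.
have -> : (fun y => `|phi y - phi x|) =
    (fun y => Num.sqrt (k y y - 2 * k y x + k x x)).
  by apply/funext => y; rewrite -sqr_feature_dist sqrtr_sqr normr_id.
have e : Num.sqrt (k x x - 2 * k x x + k x x) = 0 :> R.
  by rewrite (_ : _ + _ = 0) ?sqrtr0//; ring.
have h : (k y y - 2 * k y x + k x x) @[y --> x] --> k x x - 2 * k x x + k x x.
  apply: cvgD; last exact: cvg_cst.
  apply: cvgB.
    by apply: (cvg_comp (fun y => (y, y)) _ _ (kc (x, x))); apply: cvg_pair; exact: cvg_id.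
  apply: cvgM; first exact: cvg_cst.
  apply: (cvg_comp (fun y => (y, x)) _ _ (kc (x, x))).
  by apply: cvg_pair; [exact: cvg_id|exact: cvg_cst].
by rewrite -e; apply: (cvg_comp _ _ h); exact: sqrt_continuous.
Qed.

Lemma dot_cvg (u v : nat -> H) (a b : H) : u @ \oo --> a -> v @ \oo --> b ->
  dot (u n) (v n) @[n --> \oo] --> dot a b.
Proof.
move=> ua vb.
(* Polarization reduces the claim to continuity of the norm. *)
have P x y : dot x y = (`|x + y| ^+ 2 - `|x| ^+ 2 - `|y| ^+ 2) / 2.
  by rewrite -!rkhs_dotnormE sqr_dotnormD; field.
under eq_fun do rewrite P.
rewrite P; apply: cvgMl; apply: cvgB; first apply: cvgB.
- by apply: cvgM; apply: cvg_norm; exact: cvgD.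
- by apply: cvgM; exact: cvg_norm.
- by apply: cvgM; exact: cvg_norm.
Qed.

Hypothesis k_continuous : continuous (fun p : S * S => k p.1 p.2).

Lemma feature_measurable (y : H) :
  measurable_fun (setT : set (borelType S)) (fun x => `|phi x - y|).
Proof.
apply: (measurability _ (RGenOpens.measurableE R)) => _ [_ [a [b ->] <-]].
rewrite setTI; apply: sub_sigma_algebra.
apply: open_comp; last exact: interval_open.
move=> x _; apply: cvg_norm; apply: cvgB; last exact: cvg_cst.
exact: feature_continuous.
Qed.

Variable pt : nat -> S.

(** The recursive form supports the proof of measurability by induction on M; ties keep the earlier
    index. *)
Fixpoint nearest (M : nat) (x : S) : nat :=
  if M is M'.+1 then
    if `|phi x - phi (pt M)| < `|phi x - phi (pt (nearest M' x))| then M else nearest M' x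
  else 0.

Lemma nearest_le M x : (nearest M x <= M)%N.
Proof. by elim: M => //= M IH; case: ifP => // _; exact: leqW. Qed.

Lemma nearest_dist M x j : (j <= M)%N ->
  `|phi x - phi (pt (nearest M x))| <= `|phi x - phi (pt j)|.
Proof.
elim: M j => [|M IH] j; first by rewrite leqn0 => /eqP ->.
rewrite leq_eqVlt ltnS => /predU1P[->|jM] /=; case: ltP => // h.
by rewrite (le_trans (ltW h))// IH.
by apply: IH.
Qed.

Definition quantize M (x : borelType S) : 'I_M.+1 := inord (nearest M x).

Lemma quantizeE M x : quantize M x = nearest M x :> nat.
Proof. by rewrite inordK// ltnS nearest_le. Qed.

Lemma quantize_measurable M : finite_measurable (quantize M).
Proof.
have E N a : @quantize N @^-1` [set a] = (nearest N) @^-1` [set val a].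
  apply/seteqP; split => x /= => [<-|xa]; first by rewrite quantizeE.
  by apply/val_inj; rewrite /= quantizeE.
(* The induction runs on the [nat]-valued map, as the codomain of [quantize] changes with M. The new
   point wins exactly on the set L below, where one measurable distance is smaller than another. *)
suff Hn i : measurable ((nearest M : borelType S -> nat) @^-1` [set i]).
  by move=> a; rewrite E.
elim: M i => [|M IH] i /=.
  have [->|i0] := eqVneq i 0%N.
    by rewrite (_ : _ @^-1` _ = setT)//; apply/seteqP; split.
  by rewrite (_ : _ @^-1` _ = set0)//; apply/seteqP; split => // x /= e; rewrite -e eqxx in i0.
have mq : finite_measurable (@quantize M) by move=> a; rewrite E.
pose L := [set x : borelType S | `|phi x - phi (pt M.+1)| < `|phi x - phi (pt (nearest M x))|].
have mL : measurable L.
  have mlt := measurable_fun_ltr (feature_measurable (phi (pt M.+1)))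
    (measurable_dist_finite feature_measurable (fun i : 'I_M.+1 => phi (pt i)) mq).
  rewrite (_ : L = setT `&` (fun x : borelType S => `|phi x - phi (pt M.+1)| <
      `|phi x - phi (pt (quantize M x))|) @^-1` [set true]); first exact: mlt.
  by rewrite setTI; apply/seteqP; split => x; rewrite /L /= quantizeE.
rewrite (_ : _ @^-1` _ = (L `&` [set _ | M.+1 = i]) `|` (~` L `&` (nearest M) @^-1` [set i])).
  apply: measurableU; apply: measurableI => //; last exact: measurableC.
  have [->|/eqP iM] := eqVneq M.+1 i.
    by rewrite (_ : [set _ | _] = setT)//; apply/seteqP; split.
  by rewrite (_ : [set _ | _] = set0)//; apply/seteqP; split.
apply/seteqP; split => x /=; rewrite /L /=; case: ifP => //= h.
- by left.
- by move=> e; right; split => //; rewrite h.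
- by case=> [[_ ->]|[/(_ isT)]].
- by case=> [[]|[_ ->]].
Qed.

Definition quantized_feature M (i : 'I_M.+1) : H := phi (pt i).

Hypothesis pt_dense : dense (range pt).

(** The points with feature within e of phi x form a nonempty open set, which contains some pt j;
    for M >= j the selected point is at least as near. *)
Lemma quantize_cvg x : quantized_feature (quantize M x) @[M --> \oo] --> phi x.
Proof.
apply/cvgrPdist_lt => e e0.
have oU : open [set y | `|phi x - phi y| < e].
  rewrite (_ : [set y | _] = (fun y => `|phi x - phi y|) @^-1` [set z | z < e])//.
  apply: open_comp; last exact: open_lt.
  move=> y _; apply: cvg_norm; apply: cvgB; first exact: cvg_cst.
  exact: feature_continuous.
have [|y [/= ye [j _ jy]]] := pt_dense _ oU; first by exists x; rewrite /= subrr normr0.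
exists j => // M jM /=; rewrite /quantized_feature quantizeE.
by apply: le_lt_trans (nearest_dist x jM) _; rewrite jy.
Qed.

End Feature.

(** * Passage to the limit *)

(** Entries are grouped by lag t - 1, which occurs 2 (s - t + 1) times off the diagonal. In the
    induction the new row and column agree by symmetry and contain each positive lag once. *)
Lemma sum_stationary {R : realType} (G : nat -> nat -> R) (s : nat) :
  (forall i j, G i j = G j i) -> (forall h i j, G (h + i)%N (h + j)%N = G i j) ->
  \sum_(i < s) \sum_(j < s) G i j =
  s%:R * G 0 0 + 2 * \sum_(2 <= t < s.+1) (s - t + 1)%:R * G t.-1 0.
Proof.
move=> Gsym Gshift; elim: s => [|s IH].
  by rewrite big_ord0 mul0r big_geq// mulr0 addr0.
have diag i : G i i = G 0%N 0%N by rewrite -[in LHS](addn0 i) Gshift.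
rewrite big_ord_recr/= (eq_bigr (fun i : 'I_s => \sum_(j < s) G i j + G i s)); last first.
  by move=> i _; rewrite big_ord_recr.
rewrite big_split/= IH big_ord_recr/= (diag s).
have -> : \sum_(i < s) G s i = \sum_(i < s) G i s by apply: eq_bigr => i _; rewrite Gsym.
have -> : \sum_(i < s) G i s = \sum_(2 <= t < s.+2) G t.-1 0%N.
  rewrite (big_addn 0 s.+2 2) subn2 big_mkord (reindex_inj rev_ord_inj)/=.
  apply: eq_bigr => i _; rewrite addn2/= Gsym.
  have {1}-> : s = ((s - i.+1) + i.+1)%N by rewrite subnK.
  by rewrite -[in X in G _ X](addn0 (s - i.+1)%N) Gshift.
have -> : \sum_(2 <= t < s.+1) (s - t + 1)%:R * G t.-1 0%N =
    \sum_(2 <= t < s.+2) (s.+1 - t)%:R * G t.-1 0%N.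
  case: (s) => [|u]; first by rewrite !big_geq.
  rewrite [RHS]big_nat_recr//= subnn mul0r addr0; apply: eq_big_nat => t /andP[_ tu].
  by rewrite addn1 -subSn.
have -> : \sum_(2 <= t < s.+2) (s.+1 - t + 1)%:R * G t.-1 0%N =
    \sum_(2 <= t < s.+2) (s.+1 - t)%:R * G t.-1 0%N + \sum_(2 <= t < s.+2) G t.-1 0%N.
  by rewrite -big_split/=; apply: eq_bigr => t _; rewrite natrD mulrDl mul1r.
by rewrite -natr1; ring.
Qed.

Section FeatureConcentration.
Context {d} {Om : measurableType d} {S : ptopologicalType} {R : realType}.
Context {k : S -> S -> R} (H : rkhs k).
Variables (Pr : probability Om R) (X : nat -> {RV Pr >-> borelType S}) (pt : nat -> S).
Hypothesis k_continuous : continuous (fun p : S * S => k p.1 p.2).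
Hypothesis pt_dense : dense (range pt).
Hypothesis X_stationary : stationary X.
Variable kappa : R.
Hypothesis feature_le : forall x, `|rkhs_feature H x| <= kappa.
Local Notation phi := (rkhs_feature H).
Local Notation dot := (rkhs_dot H).

Let f M : borelType S -> 'I_M.+1 := @quantize R S k H pt M.
Let psi M : 'I_M.+1 -> H := @quantized_feature R S k H pt M.
Arguments psi : clear implicits.
Lemma quantizer_measurable M : finite_measurable (f M).
Proof. exact: quantize_measurable. Qed.
Arguments quantizer_measurable : clear implicits.

Let qmean M : H := \sum_a law Pr (f M \o X 0) a *: psi M a.
Let mu : H := mean_embedding H (marginal X).

Lemma quantized_cvg x : psi M (f M x) @[M --> \oo] --> phi x.
Proof. exact: quantize_cvg. Qed.

Lemma quantized_mean_cvg : qmean M @[M --> \oo] --> mu.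
Proof.
have e M : qmean M = simple_vintegral (marginal X) (psi M \o f M).
  by rewrite (finite_simple_vintegral _ _ (quantizer_measurable M)).
under eq_fun do rewrite e.
apply: bochner_integral_cvg.
- exact: feature_measurable.
- by move=> M; exact: (finite_simple_vfun _ (quantizer_measurable M)).
- exact: quantized_cvg.
have mdist M : measurable_fun setT (fun x : borelType S => `|phi x - psi M (f M x)|).
  exact: (measurable_dist_finite (feature_measurable k_continuous) _ (quantizer_measurable M)).
have dist2 M x : `|phi x - psi M (f M x)| <= 2 * kappa.
  by apply: le_trans (ler_normB _ _) _; rewrite mulr_natl mulr2n; apply: lerD; exact: feature_le.
apply/fine_cvgP; split.
  apply: nearW => M; apply: integrable_fin_num => //.
  have := @bounded_integrable _ _ _ (marginal X) _ (2 * kappa) (mdist M); apply.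
  by move=> x; rewrite normr_id; exact: dist2.
have -> : 0 = \int[marginal X]_x (0 : R) :> R by rewrite Rintegral_cst// mul0r.
apply: (@bounded_cvg _ _ _ (marginal X) _ _ (2 * kappa)) => [M|M x|x].
- exact: mdist.
- by rewrite normr_id; exact: dist2.
rewrite -(normr0 H) -(subrr (phi x)); apply: cvg_norm; apply: cvgB; first exact: cvg_cst.
exact: quantized_cvg.
Qed.

Let qdev M t w : H := psi M (f M (X t w)) - qmean M.
Let dev t w : H := phi (X t w) - mu.
Let qcov M i j := \int[Pr]_w dot (qdev M i w) (qdev M j w).
Let cov i j := \int[Pr]_w dot (dev i w) (dev j w).

Lemma quantized_deviation_cvg t w : qdev M t w @[M --> \oo] --> dev t w.
Proof. by apply: cvgB; [exact: quantized_cvg|exact: quantized_mean_cvg]. Qed.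

Lemma quantized_mean_le M : `|qmean M| <= kappa.
Proof.
apply: le_trans (ler_norm_sum _ _ _) _.
rewrite -[leRHS]mul1r -(law_sum1 Pr (coordinate_measurable X (quantizer_measurable M) 0)) mulr_suml.
apply: ler_sum => a _; rewrite normrZ ger0_norm ?law_ge0// ler_wpM2l ?law_ge0//.
exact: feature_le.
Qed.

Lemma quantized_deviation_le M t w : `|qdev M t w| <= 2 * kappa.
Proof.
apply: le_trans (ler_normB _ _) _; rewrite mulr_natl mulr2n.
by apply: lerD; [exact: feature_le|exact: quantized_mean_le].
Qed.

Lemma quantized_covariance_cvg i j : qcov M i j @[M --> \oo] --> cov i j.
Proof.
apply: (@bounded_cvg _ _ _ _ _ _ ((2 * kappa) * (2 * kappa))).
- move=> M.
  apply: (@finite_measurable_fun _ _ _ _ _ (fun w => (f M (X i w), f M (X j w)))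
    (fun u => dot (psi M u.1 - qmean M) (psi M u.2 - qmean M))).
  by apply: finite_measurable_pair; exact: (coordinate_measurable X (quantizer_measurable M)).
- move=> M w; apply: le_trans (dot_cauchy_schwarz _ _ _) _.
  by rewrite !rkhs_dotnormE ler_pM// quantized_deviation_le.
- by move=> w; apply: dot_cvg; exact: quantized_deviation_cvg.
Qed.

Lemma quantized_covariance_block M s (i j : 'I_s) h : qcov M (h + i) (h + j) =
  \sum_x law Pr (block X (f M) s 0) x *
    dot (psi M (tnth x i) - qmean M) (psi M (tnth x j) - qmean M).
Proof.
under eq_bigr do rewrite -(law_block_stationary (quantizer_measurable M) X_stationary h).
rewrite -(Rintegral_finite Pr (fun x : s.-tuple 'I_M.+1 => dot (psi M (tnth x i) - qmean M)
  (psi M (tnth x j) - qmean M)) (block_measurable X (quantizer_measurable M) h)).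
by apply: eq_Rintegral => w _; rewrite !tnth_mktuple.
Qed.

(** The quantized covariances are exactly shift invariant, being functions of the law of one block
    that contains both times; uniqueness of limits transfers this to [cov]. *)
Lemma covariance_shift h i j : cov (h + i)%N (h + j)%N = cov i j.
Proof.
have e M : qcov M (h + i)%N (h + j)%N = qcov M i j.
  have il : (i < (maxn i j).+1)%N by rewrite ltnS leq_maxl.
  have jl : (j < (maxn i j).+1)%N by rewrite ltnS leq_maxr.
  rewrite (quantized_covariance_block M (Ordinal il) (Ordinal jl) h).
  by rewrite -(quantized_covariance_block M (Ordinal il) (Ordinal jl) 0).
have h' : qcov M i j @[M --> \oo] --> cov (h + i)%N (h + j)%N.
  by under eq_fun do rewrite -e; exact: quantized_covariance_cvg.
by apply: cvg_unique h' (@quantized_covariance_cvg i j); exact: norm_hausdorff.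
Qed.

Lemma covariance_sym i j : cov i j = cov j i.
Proof. by apply: eq_Rintegral => w _; rewrite dotC. Qed.

Lemma covariance_variance : cov 0%N 0%N = embedding_variance H (marginal X).
Proof.
rewrite /embedding_variance /Rintegral.
rewrite [in RHS]/marginal /distribution ge0_integral_pushforward//=.
- by congr fine; apply: eq_integral => w _; rewrite -rkhs_dotnormE sqr_dotnorm.
- apply/measurable_EFinP; apply: measurable_funX.
  exact: (feature_measurable k_continuous).
Qed.

Lemma sum_covariance tau : \sum_(i < tau) \sum_(j < tau) cov i j =
  tau%:R * (embedding_variance H (marginal X) + Sigma H X tau).
Proof.
rewrite (sum_stationary _ covariance_sym covariance_shift) covariance_variance mulrDr.
congr (_ + _).
have [->|t0] := eqVneq tau 0%N; first by rewrite big_geq// mul0r mulr0.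
rewrite /Sigma mulrA; congr (_ * _).
by field; rewrite pnatr_eq0.
Qed.

Let qsum M n w : H := \sum_(t < n) qdev M t w.

Lemma quantized_sum_cvg n w : qsum M n w @[M --> \oo] --> \sum_(t < n) dev t w.
Proof. by apply: cvg_big => [|t _]; [exact: add_continuous|exact: quantized_deviation_cvg]. Qed.

Lemma quantized_sum_measurable M n : measurable_fun setT (fun w => `|qsum M n w|).
Proof.
have -> : (fun w => `|qsum M n w|) = (fun w => `|\sum_(t < n)
    (psi M (tnth (block X (f M) n 0 w) t) - qmean M)|).
  by apply/funext => w; congr `|_|; apply: eq_bigr => t _; rewrite tnth_mktuple.
apply: (@finite_measurable_fun _ _ _ _ _ (block X (f M) n 0)
  (fun x => `|\sum_(t < n) (psi M (tnth x t) - qmean M)|)).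
exact: (block_measurable X (quantizer_measurable M) 0).
Qed.

Lemma deviation_sum_measurable n :
  measurable_fun setT (fun w => `|\sum_(t < n) (phi (X t w) - mu)|).
Proof.
apply: (measurable_fun_cvg (h := fun M w => `|qsum M n w|)).
  by move=> M; exact: quantized_sum_measurable.
by move=> w _; apply: cvg_norm; exact: quantized_sum_cvg.
Qed.

(** [finite_concentration] holds at every level M with threshold rM. The quantized block variance
    converges to the sum of covariances over a block, computed in [sum_covariance], so rM tends to
    r. *)
Lemma feature_concentration tau m (b L r : R) : 0 < L -> (1 < m)%N -> (beta_mix X tau <= b%:E)%E ->
  r = 2 * Num.sqrt (m%:R * (tau%:R * (embedding_variance H (marginal X) + Sigma H X tau)) * L)
    + 4 / 3 * (2 * tau%:R * kappa) * L ->
  fine (Pr [set w | r < `|\sum_(t < m * tau) (phi (X t w) - mu)|]) <=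
  2 * expR (- L) + b * (m - 2)%:R.
Proof.
move=> L0 m1 Xb rE.
have kappa0 : 0 <= kappa by exact: le_trans (feature_le point).
pose z M (x : tau.-tuple 'I_M.+1) := \sum_i (psi M (tnth x i) - qmean M).
pose var M := \sum_x law Pr (block X (f M) tau 0) x * dotnorm dot (z M x) ^+ 2.
have varE M : var M = \sum_(i < tau) \sum_(j < tau) qcov M i j.
  under [RHS]eq_bigr => i _ do under eq_bigr => j _ do
    rewrite -[X in qcov _ X _]add0n -[X in qcov _ _ X]add0n (quantized_covariance_block M i j 0).
  under [RHS]eq_bigr => i _ do rewrite exchange_big.
  rewrite exchange_big; apply: eq_bigr => x _.
  under eq_bigr do rewrite -mulr_sumr.
  rewrite -mulr_sumr sqr_dotnorm; congr (_ * _).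
  by rewrite /z dot_suml; apply: eq_bigr => i _; rewrite linear_sumr.
have var_cvg : var M @[M --> \oo] -->
    tau%:R * (embedding_variance H (marginal X) + Sigma H X tau).
  rewrite -sum_covariance; under eq_fun do rewrite varE.
  apply: cvg_big => [|i _]; first exact: add_continuous.
  by apply: cvg_big => [|j _]; [exact: add_continuous|exact: quantized_covariance_cvg].
(* The vanishing summand keeps c positive even when tau or kappa is zero. *)
pose c M := 2 * tau%:R * kappa + M.+1%:R^-1.
pose rM M := 2 * Num.sqrt (m%:R * var M * L) + 4 / 3 * c M * L.
have c_cvg : c M @[M --> \oo] --> 2 * tau%:R * kappa.
  rewrite -[X in _ --> X]addr0; apply: cvgD; first exact: cvg_cst.
  exact: cvg_harmonic.
have rM_cvg : rM M @[M --> \oo] --> r.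
  rewrite rE.
  apply: cvgD.
    apply: cvgM; first exact: cvg_cst.
    apply: (cvg_comp (fun M => m%:R * var M * L)); last exact: sqrt_continuous.
    by apply: cvgMl; apply: cvgM => //; exact: cvg_cst.
  by apply: cvgMl; apply: cvgM => //; exact: cvg_cst.
apply: (@probability_liminf_le _ _ _ Pr (fun M => [set w | rM M < `|qsum M (m * tau) w|])).
- by move=> M; apply: measurable_superlevel; exact: quantized_sum_measurable.
- by apply: measurable_superlevel; exact: deviation_sum_measurable.
- move=> M.
  have := @finite_concentration _ _ _ _ _ Pr X _ (f M) tau _ dot (psi M) (quantizer_measurable M)
    X_stationary kappa (c M) L (rM M) b m.
  rewrite (_ : [set w | _] = [set w | rM M < `|qsum M (m * tau) w|]); last first.
    by apply/seteqP; split => w /=; rewrite rkhs_dotnormE.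
  apply => //.
  + by move=> a; rewrite rkhs_dotnormE; exact: feature_le.
  + by rewrite lerDl invr_ge0.
  + by rewrite ltr_wpDl ?invr_gt0// mulr_ge0// mulr_ge0.
- move=> w /= rw.
  have D : `|qsum M (m * tau) w| - rM M @[M --> \oo] -->
      `|\sum_(t < m * tau) dev t w| - r.
    by apply: cvgB => //; apply: cvg_norm; exact: quantized_sum_cvg.
  have D0 : 0 < `|\sum_(t < m * tau) dev t w| - r by rewrite subr_gt0.
  near=> M; rewrite -subr_gt0; near: M; exact: cvgr_gt _ D _ D0.
Unshelve. all: by end_near.
Qed.

End FeatureConcentration.

(** A larger gap shrinks the future sigma-field, hence the set of admissible partitions. This
    carries the bound from the mixing time to the block length. *)
Lemma beta_mix_nonincreasing {d d'} {Om : measurableType d} {S : measurableType d'}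
    {R : realType} (Pr : probability Om R) (X : nat -> {RV Pr >-> S}) (s t : nat) :
  (s <= t)%N -> (beta_mix X t <= beta_mix X s)%E.
Proof.
move=> st; apply: ub_ereal_sup => _ [r _ <-].
apply: (@le_trans _ _ (beta_coef Pr (sigma_process X [set u | (u <= r)%N])
    (sigma_process X [set u | (r + s <= u)%N]))); last first.
  by apply: ereal_sup_ubound; exists r.
apply: le_ereal_sup => _ [p [q [a [b [pa pb Aa Bb ->]]]]].
exists p, q, a, b; split => // j; move: (b j) (Bb j); apply: sub_sigma_algebra2.
apply: bigcup_subset => i /=; exact: leq_trans (leq_add _ st).
Qed.

(** The dense set is enumerated by inverting its injection into [nat]; indices without a preimage
    are sent to [point], and the larger range stays dense. *)
Lemma separable_dense_seq (S : ptopologicalType) : separable S ->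
  exists pt : nat -> S, dense (range pt).
Proof.
move=> [D /countable_injP[g ginj] dD].
pose pt i := xget point [set x | D x /\ g x = i].
exists pt => O O0 oO; have [x [Ox Dx]] := dD O O0 oO.
exists x; split => //; exists (g x) => //; rewrite /pt.
case: xgetP => [y -> [Dy gyx]|/(_ x)]; last by case.
exact: (ginj _ _ (mem_set Dy) (mem_set Dx) gyx).
Qed.

Theorem theorem5p2 (R : realType) (d : measure_display)
    (Om : measurableType d) (Pr : probability Om R)
    (S : ptopologicalType) (k : S -> S -> R) (H : rkhs k)
    (X : nat -> {RV Pr >-> borelType S}) (delta : R) (n tau : nat)
    (S_separable : separable S)
    (k_continuous : continuous (fun p : S * S => k p.1 p.2))
    (k_bounded : bounded_kernel k)
    (k_posdef : positive_definite_kernel k)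
    (delta01 : 0 < delta < 1)
    (X_stationary : stationary X)
    (X_mixing : beta_mixing X)
    (tau_block : is_block_length X n delta tau)
    (tau_dvd : (tau %| n)%N) :
  let kbar := sup (range (fun x => k x x)) in
  let v := embedding_variance H (marginal X) in
  let bound := 2 * Num.sqrt ((v + Sigma H X tau) * (ln (3 / delta) / n%:R))
               + 8 / 3 * tau%:R * Num.sqrt kbar * (ln (3 / delta) / n%:R) in
  ((1 - delta)%:E <=
   Pr [set w | (`|empirical_embedding H X n w - mean_embedding H (marginal X)|
                <= bound)%R])%E.
Proof.
cbv zeta; set kbar := sup _; set v := embedding_variance _ _; set bound := 2 * _ + _.
have [pt pt_dense] := separable_dense_seq S_separable.
have [[tau1 /andP[xi0 xi1] [t [[t1 Xt] _] ttau]] _] := tau_block.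
pose xi : R := delta / (6 * (n%:R / (2 * tau%:R) - 1)).
have /andP[d0 d1] := delta01.
have Xb : (beta_mix X tau <= xi%:E)%E.
  exact: le_trans (beta_mix_nonincreasing _ ttau) (ltW Xt).
have tauR : 0 < tau%:R :> R by rewrite ltr0n.
pose m := (n %/ tau)%N.
have nE : n = (m * tau)%N by rewrite divnK.
(* Hence xi = delta / (3 (m - 2)), and its positivity forces m > 2. *)
have nmt : n%:R / (2 * tau%:R) = m%:R / 2 :> R.
  by rewrite nE natrM; field; rewrite gt_eqF.
have m2 : (2 < m)%N.
  rewrite -(ltr_nat R) -subr_gt0; move: xi0; rewrite nmt pmulr_rgt0// invr_gt0.
  by lra.
have m2R : 0 < m%:R - 2 :> R by rewrite subr_gt0 ltr_nat.
have mR : 0 < m%:R :> R by lra.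
have n0 : 0 < n%:R :> R by rewrite ltr0n nE muln_gt0 (ltn_trans _ m2).
have L0 : 0 < ln (3 / delta) by rewrite ln_gt0// ltr_pdivlMr// mul1r; lra.
have phik x : `|rkhs_feature H x| <= Num.sqrt kbar by exact: feature_norm_le.
have key := feature_concentration (H := H) k_continuous pt_dense X_stationary phik L0
  (ltnW m2) Xb erefl.
set r := (X in [set w | X < _]) in key.
(* Multiplying by n = m tau turns the mean into the sum; the constant 8 / 3 is 4 / 3 times the 2 of
   the block bound 2 tau sqrt kbar. *)
have rE : r = n%:R * bound.
  have e1 : Num.sqrt (m%:R * (tau%:R * (v + Sigma H X tau)) * ln (3 / delta)) =
      n%:R * Num.sqrt ((v + Sigma H X tau) * (ln (3 / delta) / n%:R)).
    rewrite -[X in X * Num.sqrt _]ger0_norm ?ltW// -sqrtr_sqr -sqrtrM ?sqr_ge0//.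
    by congr Num.sqrt; rewrite nE natrM; field; rewrite !gt_eqF.
  by rewrite /r -/v e1 /bound; field; rewrite gt_eqF.
have eS w : `|\sum_(t < m * tau) (rkhs_feature H (X t w) - mean_embedding H (marginal X))| =
    n%:R * `|empirical_embedding H X n w - mean_embedding H (marginal X)|.
  rewrite -[X in X * _]ger0_norm ?ltW// -normrZ scalerBr scalerA mulfV ?gt_eqF// scale1r.
  by rewrite -nE sumrB sumr_const card_ord scaler_nat.
pose B := [set w | r < `|\sum_(t < m * tau)
  (rkhs_feature H (X t w) - mean_embedding H (marginal X))|].
have eB : [set w | `|empirical_embedding H X n w - mean_embedding H (marginal X)| <= bound] =
    ~` B.
  apply/seteqP; split => w /=; rewrite /B /= eS rE ltr_pM2l// ltNge.
    by move=> ->.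
  by move=> /negP; rewrite negbK.
have mB : measurable B.
  apply: measurable_superlevel; apply: deviation_sum_measurable;
    [exact: k_continuous|exact: pt_dense|exact: phik].
rewrite eB probability_setC//.
rewrite -[Pr B]fineK ?fin_num_measure// -EFinB lee_fin lerD2l lerN2.
apply: le_trans key _.
(* Here 2 e^(- L) = 2 delta / 3 and xi (m - 2) = delta / 3, which add up to delta. *)
rewrite expRN lnK ?posrE ?divr_gt0// natrB; last exact: ltnW.
rewrite /xi nmt le_eqVlt; apply/orP; left; apply/eqP.
by field; rewrite !gt_eqF//; lra.
Qed.
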